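(* Let $n\geq 2$. Let $\widetilde{\mathcal G}(n)=\langle x_1,\ldots,x_n,y_1,\ldots,y_n\rangle$ be the finite $2$-group with the defining relations, for all $1\le i,j,k\le n$, $$x_i^2=y_i^2=1,\quad [x_i,x_j]=[y_i,y_j]=1,\quad [x_i,y_j]^2=1,\quad [[x_i,y_j],x_k]=[[x_i,y_j],y_k]=1.$$ Let $X=\langle x_1,\ldots,x_n\rangle$, $Y=\langle y_1,\ldots,y_n\rangle$, $\Gamma=C(\widetilde{\mathcal G}(n),X,Y)$, $\Sigma=\Sigma(\widetilde{\mathcal G}(n),X,Y)$ and $N=\langle [x_i,y_j]\mid 1\leq i,j\leq n\rangle$. Then (1) $\widetilde{\mathcal G}(n)$ is an $n$-dimensional mixed dihedral group relative to $X$ and $Y$, with derived subgroup $\widetilde{\mathcal G}(n)'=N\cong C_2^{n^2}$; (2) $\Sigma$ is a $2$-arc-transitive $N$-normal cover of $\mathbf{K}_{2^n,2^n}$, of order $2^{n^2+n+1}$, and $\mathbf{K}_{2^n,2^n}\cong\Sigma_N$ is $\widetilde{\mathcal G}(n)/N$-edge-affine; (3) $\Gamma$ is a $2$-geodesic-transitive normal Cayley graph; moreover, $\Gamma$ is $2$-distance-transitive, but it is neither distance-transitive nor $2$-arc-transitive.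
   Context: All graphs are finite, connected, simple and undirected; the order of a graph is its number of vertices. $[a,b]=a^{-1}b^{-1}ab$. A finite group $H$ with subgroups $X,Y$ is an $n$-dimensional mixed dihedral group relative to $X$ and $Y$ if $X\cong Y\cong C_2^n$, $H=\langle X\cup Y\rangle$ and $H/H'\cong C_2^{2n}$. For an inverse-closed $S\subseteq H\setminus\{1\}$, $\mathrm{Cay}(H,S)$ has vertex set $H$ and edges $\{g,sg\}$ ($g\in H,s\in S$). The group $H$ acts by right multiplication as a regular subgroup of $\mathrm{Aut}(\mathrm{Cay}(H,S))$; $\mathrm{Cay}(H,S)$ is a normal Cayley graph if this subgroup is normal in $\mathrm{Aut}(\mathrm{Cay}(H,S))$. For a mixed dihedral group $H$ relative to $X,Y$ (with $n\ge2$): $C(H,X,Y)=\mathrm{Cay}(H,(X\cup Y)\setminus\{1\})$, and $\Sigma(H,X,Y)$ is the graph with vertex set $\{Xh: h\in H\}\cup\{Yh: h\in H\}$ and edge set $\{\{Xh,Yg\}: h,g\in H,\ Xh\cap Yg\neq\emptyset\}$. $H$ acts on $\Sigma(H,X,Y)$ by right multiplication. A $2$-arc is a triple $(u,v,w)$ of vertices with $u\neq w$ and $\{u,v\},\{v,w\}$ edges; a graph is $2$-arc-transitive if its automorphism group is transitive on $2$-arcs. For $N\lhd G\leq \mathrm{Aut}(\Sigma)$ with $G$ transitive on $V(\Sigma)$, the $N$-normal quotient $\Sigma_N$ has as vertices the $N$-orbits in $V(\Sigma)$, two distinct $N$-orbits being adjacent if some edge of $\Sigma$ has one end in each. $\Sigma$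 is an $N$-normal cover of a graph $\Delta$ if, for some such $G$, $\Sigma_N\cong\Delta$ and $\Sigma,\Delta$ have the same valency. $\mathbf{K}_{2^n,2^n}$ is $L$-edge-affine if $L\leq S_{2^n}\wr S_2=\mathrm{Aut}(\mathbf{K}_{2^n,2^n})$ and $L$ has a normal subgroup isomorphic to $C_2^n\times C_2^n$ that is intransitive on vertices and regular on edges (here $L=\widetilde{\mathcal G}(n)/N$ in its induced faithful action on $\Sigma_N$). A graph $\Gamma$ is $2$-geodesic-transitive if it is vertex-transitive and $\mathrm{Aut}(\Gamma)$ is transitive on the set of triples $(u,v,w)$ of vertices with $u\ne w$, $\{u,v\},\{v,w\}\in E(\Gamma)$ and $\{u,w\}\notin E(\Gamma)$. A non-complete graph $\Gamma$ of diameter $d\ge2$ is $2$-distance-transitive (respectively distance-transitive) if $\mathrm{Aut}(\Gamma)$ is transitive on the set of ordered pairs of vertices at distance $i$ for each $i=0,1,2$ (respectively each $i=0,1,\dots,d$). *)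

(* Defs.v *)
From HB Require Import structures.
From mathcomp Require Import all_boot all_algebra all_fingroup all_solvable.

Set Implicit Arguments.
Unset Strict Implicit.
Unset Printing Implicit Defensive.

Import GroupScope.

Section Graphs.
Variables (T : finType) (e : rel T).

Definition simple_connected_graph : Prop :=
  [/\ symmetric e, irreflexive e & forall u v, connect e u v].

Definition is_aut (s : {perm T}) : bool :=
  [forall u, forall v, e (s u) (s v) == e u v].

Definition gaut : {set {perm T}} := [set s | is_aut s].

Fact gaut_group_set : group_set gaut.
Proof.
apply/group_setP; split=> [|s t].
  by rewrite inE; apply/forallP=> u; apply/forallP=> v; rewrite !perm1.
rewrite !inE => /forallP aut_s /forallP aut_t.
apply/forallP=> u; apply/forallP=> v; rewrite !permM.
by rewrite (eqP (forallP (aut_t _) _)) (eqP (forallP (aut_s _) _)).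
Qed.
Canonical gaut_group := Group gaut_group_set.

Definition vertex_transitive : bool := [transitive gaut, on [set: T] | 'P].

Definition two_arc (u v w : T) : bool := [&& u != w, e u v & e v w].

Definition two_arc_transitive : Prop :=
  forall u v w u' v' w', two_arc u v w -> two_arc u' v' w' ->
  exists2 s, s \in gaut & [/\ s u = u', s v = v' & s w = w'].

Definition two_geodesic (u v w : T) : bool := two_arc u v w && ~~ e u w.

Definition two_geodesic_transitive : Prop :=
  vertex_transitive /\
  forall u v w u' v' w', two_geodesic u v w -> two_geodesic u' v' w' ->
  exists2 s, s \in gaut & [/\ s u = u', s v = v' & s w = w'].

Definition walk (k : nat) (u v : T) : bool :=
  [exists p : k.-tuple T, path e u p && (last u p == v)].

(* The least length of a walk from u to v; the junk value #|T| is returned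
   when v is not reachable from u. *)
Definition gdist (u v : T) : nat := find (fun k => walk k u v) (iota 0 #|T|).

Definition diameter : nat := \max_(u : T) \max_(v : T) gdist u v.

Definition complete_graph : Prop := forall u v, u != v -> e u v.

Definition distance_transitive_upto (d : nat) : Prop :=
  forall i, i <= d -> forall u v u' v', gdist u v = i -> gdist u' v' = i ->
  exists2 s, s \in gaut & s u = u' /\ s v = v'.

Definition two_distance_transitive : Prop :=
  [/\ ~ complete_graph, 2 <= diameter & distance_transitive_upto 2].

Definition distance_transitive : Prop :=
  [/\ ~ complete_graph, 2 <= diameter & distance_transitive_upto diameter].

Definition has_valency (k : nat) : Prop := forall u, #|[set v | e u v]| = k.

Definition edges : {set {set T}} :=
  [set [set p.1; p.2] | p : T * T & e p.1 p.2].

End Graphs.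

Definition graph_iso (T1 T2 : finType) (e1 : rel T1) (e2 : rel T2) : Prop :=
  exists2 f : T1 -> T2, bijective f & {mono f : u v / e1 u v >-> e2 u v}.

Definition complete_bipartite (m : nat) : rel ('I_m + 'I_m) :=
  fun u v => match u, v with
             | inl _, inr _ | inr _, inl _ => true
             | _, _ => false
             end.

Section Quotients.
Variables (T : finType) (N : {group {perm T}}).

Definition orbit_type : finType :=
  {B : {set T} | B \in orbit 'P N @: [set: T]}.

Definition quotient_graph (e : rel T) : rel orbit_type :=
  fun B C => (B != C) && [exists u in val B, exists v in val C, e u v].

(* The permutation group that a group G normalising N induces on the set of
   N-orbits (for an arbitrary G, the elements of G which do not permute the
   N-orbits are ignored). *)
Definition induced_on_orbits (G : {group {perm T}}) : {set {perm orbit_type}} :=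
  [set s : {perm orbit_type} |
    [exists g in G, forall B, val (s B) == [set g u | u in val B]]].

Fact induced_on_orbits_group_set G : group_set (induced_on_orbits G).
Proof.
apply/group_setP; split=> [|s t].
  rewrite inE; apply/existsP; exists 1; rewrite group1; apply/forallP=> B.
  apply/eqP; rewrite perm1 -[LHS]imset_id; apply: eq_imset => u.
  by rewrite perm1.
rewrite !inE => /existsP[g /andP[Gg /forallP s_g]].
case/existsP=> h /andP[Gh /forallP t_h].
apply/existsP; exists (g * h); rewrite groupM //=; apply/forallP=> B.
rewrite permM (eqP (t_h _)) (eqP (s_g _)) -imset_comp.
by apply/eqP/eq_imset => u; rewrite /= permM.
Qed.
Canonical induced_on_orbits_group G := Group (induced_on_orbits_group_set G).

Definition normal_cover (e : rel T) (D : finType) (d : rel D) : Prop :=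
  [/\ exists G : {group {perm T}},
        [/\ G \subset gaut e, N <| G & [transitive G, on [set: T] | 'P]],
      graph_iso (quotient_graph e) d
    & exists k, has_valency e k /\ has_valency d k].

End Quotients.

Arguments quotient_graph {T} N e _ _.

(* 'rV['F_2]_m is regarded here as a group under addition. *)
Definition C2_pow (m : nat) : {group 'rV['F_2]_m} := [set: 'rV['F_2]_m]%G.

Definition C2_pow_square (m : nat) : {group 'rV['F_2]_m * 'rV['F_2]_m} :=
  [set: 'rV['F_2]_m * 'rV['F_2]_m]%G.

(* e is any graph isomorphic to the complete bipartite graph K_{2^n,2^n}, so
   that L is allowed to act on the vertices of a given copy of it. *)
Definition edge_affine (n : nat) (T : finType) (e : rel T)
    (L : {group {perm T}}) : Prop :=
  [/\ graph_iso e (@complete_bipartite (2 ^ n)), L \subset gaut e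
    & exists M : {group {perm T}},
      [/\ M <| L, M \isog C2_pow_square n,
          ~~ [transitive M, on [set: T] | 'P],
          [transitive M, on edges e | 'P^*]
        & {in edges e, forall E, 'C_M[E | 'P^*] = 1}]].

Section MixedDihedral.
Variables (gT : finGroupType) (X Y : {group gT}).

Definition mixed_dihedral (n : nat) : Prop :=
  [/\ X \isog C2_pow n, Y \isog C2_pow n, <<X :|: Y>> = [set: gT]
    & [set: gT] / [set: gT]^`(1) \isog C2_pow (2 * n)].

Definition cayley (S : {set gT}) : rel gT := fun g h => h * g^-1 \in S.

Definition normal_cayley (S : {set gT}) : Prop :=
  [/\ 1 \notin S, {in S, forall s, s^-1 \in S}
    & actperm 'R @* [set: gT] <| gaut (cayley S)].

Definition C_conn : {set gT} := (X :|: Y) :\ 1.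

Definition C_graph : rel gT := cayley C_conn.

Definition is_coset : pred {set gT} :=
  fun A => A \in rcosets X [set: gT] :|: rcosets Y [set: gT].

Definition Sigma_vertex : finType := {A : {set gT} | is_coset A}.

Definition Sigma_graph : rel Sigma_vertex := fun A B =>
  [|| (val A \in rcosets X [set: gT]) && (val B \in rcosets Y [set: gT])
    | (val A \in rcosets Y [set: gT]) && (val B \in rcosets X [set: gT])]
  && (val A :&: val B != set0).

Fact is_coset_rcoset A h : is_coset A -> is_coset (A :* h).
Proof.
by case/setUP=> /rcosetsP[g _ ->]; rewrite /is_coset -rcosetM !inE;
   apply/orP; [left | right]; apply/rcosetsP; exists (g * h); rewrite ?inE.
Qed.

Definition Sigma_mul (A : Sigma_vertex) (h : gT) : Sigma_vertex :=
  exist _ (val A :* h) (is_coset_rcoset h (valP A)).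

Fact Sigma_mul1 : Sigma_mul^~ 1 =1 id.
Proof. by move=> A; apply: val_inj; rewrite /= mulg1. Qed.

Fact Sigma_mulM A : act_morph Sigma_mul A.
Proof. by move=> g h; apply: val_inj; rewrite /= rcosetM. Qed.

Canonical Sigma_action := TotalAction Sigma_mul1 Sigma_mulM.

Definition Sigma_perms (K : {group gT}) : {group {perm Sigma_vertex}} :=
  (actperm Sigma_action @* K)%G.

End MixedDihedral.

Arguments Sigma_graph {gT} X Y _ _.

Definition G_relations (n : nat) (K : groupType) (x y : 'I_n -> K) : Prop :=
  forall i j k : 'I_n,
    [/\ x i ^+ 2 = 1 /\ y i ^+ 2 = 1,
        [~ x i, x j] = 1 /\ [~ y i, y j] = 1,
        [~ x i, y j] ^+ 2 = 1
      & [~ [~ x i, y j], x k] = 1 /\ [~ [~ x i, y j], y k] = 1].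

(* The defining property of a presentation, with test groups K that may be
   infinite: gT is generated by the x i and y j, which satisfy the relations,
   and every family satisfying the relations in a group K is the image of
   this one under a homomorphism. *)
Definition G_presented (n : nat) (gT : finGroupType) (x y : 'I_n -> gT) : Prop :=
  [/\ G_relations x y,
      <<[set x i | i : 'I_n] :|: [set y i | i : 'I_n]>> = [set: gT]
    & forall (K : groupType) (a b : 'I_n -> K), G_relations a b ->
      exists f : {multiplicative gT -> K},
        (forall i, f (x i) = a i) /\ (forall i, f (y i) = b i)].

(* Main.v *)
From HB Require Import structures.
Require Import Defs.
From mathcomp Require Import all_boot all_algebra all_fingroup all_solvable.
Import GRing.Theory GroupScope.

(* The group has the concrete model of triples (u, v, M) over F_2, where u and v
   are rows of length n and M is a square matrix, with the product
   (u + u', v + v', M + M' + v^T u').  Pairs of matrices in GL_n(2) and the swap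
   of X and Y act on it, and this gives the transitivity claims for Sigma and
   Gamma; the X-cosets in an N-orbit are the ones with a common v, the Y-cosets
   the ones with a common u, and so Sigma_N is complete bipartite.

   For the normality of Gamma, let s be an automorphism of Gamma that fixes 1.
   It permutes the maximal cliques, which are the cosets of X and Y, so up to
   the swap it maps each edge {h, gh} with g in X (in Y) to one whose label
   s(gh) s(h)^-1 is in X (in Y).  A word x1 y1 x2 y2 x3 y3 x4 y4 with
   nontrivial letters is trivial only if x1 = x3, x2 = x4, y1 = y3, y2 = y4 and
   one of x1 = x2, y1 = y2 holds, because a sum of three rank one matrices over
   F_2 vanishes only if they share a factor.  Comparing the octagons of Gamma
   with their images shows that the label of {h, gh} does not depend on h, so s
   is a homomorphism.  Both xyx and xyx' are at distance 3 from 1 for distinct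
   x, x', but only the first is an involution, so Gamma is not
   distance-transitive. *)

Set Implicit Arguments.
Unset Strict Implicit.
Unset Printing Implicit Defensive.

(** * The model and its universal property *)

(** The relations alone bound the group from above. The triples show that nothing collapses, and
    mapping them into every group that satisfies the relations shows that they are the group
    presented, so all later claims become computations with triples. Octagons are the cycles to look
    at because no shorter word alternating between nontrivial letters of X and Y is trivial: in
    length four the matrix component is a nonzero rank one matrix, and in length six it is a sum of
    two such matrices, which vanishes only if they agree, and then a third letter would be 1. In
    length eight there are closed words, but so few that an automorphism cannot distort them. The
    assumption n >= 2 supplies a second nontrivial letter on each side. Two octagons that share a
    path but differ in one letter can then be compared, which excludes the unwanted alternative of
    the rigidity statement. The argument is written for an ordered pair of subgroups and applied to
    (X, Y) and to (Y, X). *)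

(* (u, v, M) stands for the product of the x_i^(u_i), the y_j^(v_j) and the
   [x_i, y_j]^(M_ji), in this order. *)
Definition heis (n : nat) : Type :=
  ('rV['F_2]_n * 'rV['F_2]_n * 'M['F_2]_n)%type.

Section Model.
Variable n : nat.

HB.instance Definition _ := Finite.on (heis n).

(** The cocycle v^T u' is the cost of restoring the normal form: the x-part of h has to move left
    past the y-part of g. *)
Definition heis_mul (g h : heis n) : heis n :=
  ((g.1.1 + h.1.1)%R, (g.1.2 + h.1.2)%R, (g.2 + h.2 + g.1.2^T *m h.1.1)%R).
Definition heis_one : heis n := (0%R, 0%R, 0%R).
Definition heis_inv (g : heis n) : heis n :=
  (- g.1.1, - g.1.2, - g.2 + g.1.2^T *m g.1.1)%R.

Fact heis_mulA : associative heis_mul.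
Proof.
case=> [[u v] M] [[u' v'] M'] [[u2 v2] M2]; rewrite /heis_mul /=.
congr (_, _, _); rewrite ?addrA // [(v + v')^T%R]raddfD /= mulmxDl mulmxDr.
by rewrite !addrA [LHS](ACl (1*2*5*3*6*4)%AC).
Qed.

Fact heis_mul1 : left_id heis_one heis_mul.
Proof.
by case=> [[u v] M]; rewrite /heis_mul /= trmx0 mul0mx !add0r addr0.
Qed.

Fact heis_mulV : left_inverse heis_one heis_inv heis_mul.
Proof.
case=> [[u v] M]; rewrite /heis_mul /= linearN mulNmx ?addNr.
by rewrite addrAC addrK addNr.
Qed.

HB.instance Definition _ :=
  Finite_isGroup.Build (heis n) heis_mulA heis_mul1 heis_mulV.

Lemma heis_mulE (u v u' v' : 'rV['F_2]_n) (M M' : 'M['F_2]_n) :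
  ((u, v, M) : heis n) * (u', v', M')
    = ((u + u')%R, (v + v')%R, (M + M' + v^T *m u')%R).
Proof. by []. Qed.

End Model.

Lemma F2_cases (s : 'F_2) : {s = 0%R} + {s = 1%R}.
Proof.
case: s => [[|[|m]] lt_m] //; first by left; apply/val_inj.
by right; apply/val_inj.
Qed.

(** Exponents are coerced to natural numbers, so for s = t = 1 the left exponent is 0 while the
    right side is c * c; the relation c^2 = 1 reconciles them. *)
Lemma expgF2D (K : groupType) (c : K) (s t : 'F_2) :
  c ^+ 2 = 1 -> c ^+ (s + t)%R = c ^+ s * c ^+ t.
Proof.
by move=> c2; case: (F2_cases s) => ->; case: (F2_cases t) => ->;
  rewrite ?addr0 ?add0r ?mulg1 ?mul1g.
Qed.

Section PowerProduct.
Variables (K : groupType) (I : finType) (c : I -> K).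
Hypotheses (c_invol : forall i, c i ^+ 2 = 1)
  (c_comm : forall i j, commute (c i) (c j)).

Definition pow_prod (u : I -> 'F_2) : K := \prod_i c i ^+ u i.

Lemma pow_prodD u u' :
  pow_prod (fun i => u i + u' i)%R = pow_prod u * pow_prod u'.
Proof.
rewrite /pow_prod -prodgM_commute => [|i j _ _]; last exact: commuteX2.
by apply: eq_bigr => i _; apply: expgF2D.
Qed.

Lemma pow_prod_sqr u : pow_prod u ^+ 2 = 1.
Proof.
rewrite expg2 -pow_prodD [LHS]big1 // => i _.
by case: (F2_cases (u i)) => ->.
Qed.

Lemma pow_prod_delta u i :
  (forall j, u j = (j == i)%:R%R) -> pow_prod u = c i.
Proof.
move=> u_i; rewrite /pow_prod (eq_bigr (fun j => if j == i then c j else 1)).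
  by rewrite -big_mkcond big_pred1_eq.
by move=> j _; rewrite u_i; case: eqP.
Qed.

End PowerProduct.
Section UniversalMap.
Variables (n : nat) (K : groupType) (a b : 'I_n -> K).
Hypothesis rel_ab : G_relations a b.

(** The pair is (row, column): p = (j, i) stands for [a_i, b_j], in agreement with the entry
    M_ji. *)
Let z (p : 'I_n * 'I_n) : K := [~ a p.2, b p.1].

Let a2 i : a i ^+ 2 = 1. Proof. by case: (rel_ab i i i) => [[]]. Qed.
Let b2 i : b i ^+ 2 = 1. Proof. by case: (rel_ab i i i) => [[]]. Qed.
Let z2 p : z p ^+ 2 = 1. Proof. by case: (rel_ab p.2 p.1 p.1) => _ _ ->. Qed.
Let aa i j : commute (a i) (a j).
Proof. by apply/commgP/eqP; case: (rel_ab i j j) => _ []. Qed.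
Let bb i j : commute (b i) (b j).
Proof. by apply/commgP/eqP; case: (rel_ab i j j) => _ []. Qed.
Let za p i : commute (z p) (a i).
Proof. by apply/commgP/eqP; case: (rel_ab p.2 p.1 i) => _ _ _ []. Qed.
Let zb p i : commute (z p) (b i).
Proof. by apply/commgP/eqP; case: (rel_ab p.2 p.1 i) => _ _ _ []. Qed.
Let zz p q : commute (z p) (z q).
Proof.
(* [z q] is a word in the a's, the b's and their inverses, and [z p] commutes with each of them. *)
by do !apply: commuteM; try apply: commuteV; do ?apply: commuteM;
   try apply: commuteV; first [apply: za | apply: zb].
Qed.

Let A (u : 'rV['F_2]_n) := pow_prod a (u 0%R).
Let B (v : 'rV['F_2]_n) := pow_prod b (v 0%R).
Let C (M : 'M['F_2]_n) := \prod_j pow_prod (fun i => z (j, i)) (M j).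

Definition heis_lift (g : heis n) : K := A g.1.1 * B g.1.2 * C g.2.

Let commC M x : (forall p, commute (z p) x) -> commute (C M) x.
Proof.
move=> zx; apply/commute_sym; do 2!apply: commute_prod => ? _.
exact/commuteX/commute_sym/zx.
Qed.

Let CA M u : commute (C M) (A u).
Proof. by apply: commC => p; apply: commute_prod => i _; apply/commuteX/za. Qed.

Let CB M v : commute (C M) (B v).
Proof. by apply: commC => p; apply: commute_prod => i _; apply/commuteX/zb. Qed.

Let CD M M' : C (M + M')%R = C M * C M'.
Proof.
rewrite /C -prodgM_commute => [|j k _ _]; last first.
  apply: commute_prod => i _; apply/commute_sym; apply: commute_prod => i' _.
  exact/commuteX2/zz.
apply: eq_bigr => j _; rewrite -pow_prodD //.
by apply: eq_bigr => i _; rewrite mxE.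
Qed.

(** This is the commutator [A u, b_j], expanded linearly in u, as [conj_A_b] confirms. *)
Let w (u : 'rV['F_2]_n) j := \prod_i z (j, i) ^+ u 0%R i.

Let conj_A_b u j : A u ^ b j = A u * w u j.
Proof.
rewrite /A /w conjg_prod -prodgM_commute => [|i k _ _].
  apply: eq_bigr => i _; rewrite conjXg -expgMn; last exact/commute_sym/za.
  by rewrite -[a i ^ b j](mulKVg (a i)).
exact/commuteX2/commute_sym/za.
Qed.

Let w2 u j : w u j ^+ 2 = 1.
Proof. exact: (pow_prod_sqr (c := fun i => z (j, i))). Qed.

Let wb u j k : commute (w u j) (b k).
Proof.
by apply/commute_sym; apply: commute_prod => i _; apply/commuteX/commute_sym/zb.
Qed.

Let conj_b_A u j : b j ^ A u = b j * w u j.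
Proof.
apply: (mulgI (A u)); rewrite -conjgC mulgA (conjgC (A u)) conj_A_b.
by rewrite -!mulgA -expg2 w2 mulg1.
Qed.

(** Conjugation by [A u] multiplies each [b j] by [w u j]; the factors collected over j form the
    cocycle of [heis_mul]. *)
Let BA u v : B v * A u = A u * B v * C (v^T *m u)%R.
Proof.
rewrite conjgC -mulgA; congr (_ * _); rewrite /B conjg_prod.
transitivity (\prod_j (b j ^+ v 0%R j * w u j ^+ v 0%R j)).
  apply: eq_bigr => j _; rewrite conjXg conj_b_A expgMn //.
  exact/commute_sym/wb.
rewrite prodgM_commute => [|i j _ _]; last exact/commuteX2/commute_sym/wb.
congr (_ * _); rewrite /C /pow_prod.
apply: eq_bigr => j _.
transitivity (w u j ^+ v 0%R j) => //.
rewrite /w; set s := v 0%R j.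
have sE i : (v^T *m u)%R j i = (s * u 0%R i)%R by rewrite mxE big_ord1 !mxE.
case: (F2_cases s) sE => -> sE; apply/esym.
  by apply: big1 => i _; rewrite sE mul0r.
by apply: eq_bigr => i _; rewrite sE mul1r.
Qed.

Lemma heis_liftM : {morph heis_lift : g h / g * h}.
Proof.
case=> [[u v] M] [[u' v'] M']; rewrite heis_mulE /heis_lift /= !CD.
have pD (c : 'I_n -> K) (t t' : 'rV['F_2]_n) :
    (forall i, c i ^+ 2 = 1) -> (forall i j, commute (c i) (c j)) ->
    pow_prod c ((t + t')%R 0%R) = pow_prod c (t 0%R) * pow_prod c (t' 0%R).
  move=> c2 cc; rewrite -pow_prodD //.
  by apply: eq_bigr => i _; rewrite mxE.
rewrite {1}/A {1}/B !pD // -/(A u) -/(A u') -/(B v) -/(B v').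
have CAx M1 u1 x : C M1 * (A u1 * x) = A u1 * (C M1 * x).
  by rewrite !mulgA CA.
have CBx M1 v1 x : C M1 * (B v1 * x) = B v1 * (C M1 * x).
  by rewrite !mulgA CB.
(* The [C] factors commute with everything in sight, so the only costly exchange is that of [B v]
   with [A u']. *)
rewrite -!mulgA CAx CBx (mulgA (B v) (A u')) BA -!mulgA CBx.
by rewrite -!CD (addrC _ (M + M')%R) addrA.
Qed.

Lemma heis_lift_x i : heis_lift (delta_mx 0%R i, 0%R, 0%R) = a i.
Proof.
rewrite /heis_lift /= [A _](@pow_prod_delta _ _ a _ i) => [|j]; last first.
  by rewrite mxE eqxx.
rewrite [B _]big1 => [|j _]; last by rewrite mxE.
rewrite [C _]big1 ?mulg1 // => j _; rewrite /pow_prod big1 // => k _.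
by rewrite mxE.
Qed.

Lemma heis_lift_y i : heis_lift (0%R, delta_mx 0%R i, 0%R) = b i.
Proof.
rewrite /heis_lift /= [B _](@pow_prod_delta _ _ b _ i) => [|j]; last first.
  by rewrite mxE eqxx.
rewrite [A _]big1 => [|j _]; last by rewrite mxE.
rewrite [C _]big1 ?mulg1 ?mul1g // => j _; rewrite /pow_prod big1 // => k _.
by rewrite mxE.
Qed.

End UniversalMap.
Lemma F2_addvv (m n : nat) (M : 'M['F_2]_(m, n)) : (M + M = 0)%R.
Proof.
apply/matrixP=> i j; rewrite !mxE.
by case: (F2_cases (M i j)) => ->; apply/val_inj.
Qed.

Lemma F2_oppv (m n : nat) (M : 'M['F_2]_(m, n)) : (- M = M)%R.
Proof. by apply: (addrI M); rewrite subrr F2_addvv. Qed.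

Section ModelGroup.
Variable n : nat.
Implicit Types (u v : 'rV['F_2]_n) (M : 'M['F_2]_n).

Definition heis_x i : heis n := (delta_mx 0%R i, 0%R, 0%R).
Definition heis_y i : heis n := (0%R, delta_mx 0%R i, 0%R).

Lemma heis_split u v M :
  (u, v, M) = ((u, 0%R, 0%R) : heis n) * (0%R, v, 0%R) * (0%R, 0%R, M).
Proof. by rewrite !heis_mulE !(trmx0, mul0mx, mulmx0, addr0, add0r). Qed.

Lemma heis_commg u v M u' v' M' :
  [~ (u, v, M) : heis n, (u', v', M')]
    = (0%R, 0%R, (v^T *m u' + v'^T *m u)%R).
Proof.
apply: (mulgI (((u', v', M') : heis n) * (u, v, M))); rewrite -commgC !heis_mulE.
rewrite !(mulmx0, addr0) (addrC u) (addrC v) (addrC M).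
congr (_, _, _); rewrite -!addrA; congr (_ + (_ + _))%R.
by rewrite addrCA F2_addvv addr0.
Qed.

Lemma heis_oneE : (1 : heis n) = (0%R, 0%R, 0%R).
Proof. by []. Qed.

Lemma heis_relations : G_relations heis_x heis_y.
Proof.
move=> i j k; rewrite !expg2 !heis_commg !heis_mulE !heis_oneE.
by split; [split|split| |split];
  rewrite ?trmx0 ?mul0mx ?mulmx0 ?addr0 ?F2_addvv.
Qed.

Section Subgroup.
Variable K : {group heis n}.

Lemma heis_sub_x u : (forall i, heis_x i \in K) -> (u, 0%R, 0%R) \in K.
Proof.
move=> Kx; rewrite (row_sum_delta u).
apply: (big_ind (fun u => (u, 0%R, 0%R) \in K)); first exact: group1.
  move=> u1 u2 K1 K2; move: (groupM K1 K2).
  by rewrite heis_mulE trmx0 mul0mx !addr0.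
move=> i _; case: (F2_cases (u 0%R i)) => ->; last by rewrite scale1r Kx.
by rewrite scale0r; apply: group1.
Qed.

Lemma heis_sub_y v : (forall i, heis_y i \in K) -> (0%R, v, 0%R) \in K.
Proof.
move=> Ky; rewrite (row_sum_delta v).
apply: (big_ind (fun v => (0%R, v, 0%R) \in K)); first exact: group1.
  move=> u1 u2 K1 K2; move: (groupM K1 K2).
  by rewrite heis_mulE mulmx0 !addr0.
move=> i _; case: (F2_cases (v 0%R i)) => ->; last by rewrite scale1r Ky.
by rewrite scale0r; apply: group1.
Qed.

Lemma heis_sub_z M :
  (forall i j, [~ heis_x i, heis_y j] \in K) -> (0%R, 0%R, M) \in K.
Proof.
move=> Kz; rewrite (matrix_sum_delta M).
have KD M1 M2 : (0%R, 0%R, M1) \in K -> (0%R, 0%R, M2) \in K ->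
  (0%R, 0%R, (M1 + M2)%R) \in K.
  move=> K1 K2; move: (groupM K1 K2).
  by rewrite heis_mulE mulmx0 !addr0.
have K0 : (0%R, 0%R, 0%R) \in K by apply: group1.
apply: (big_ind (fun M0 => (0%R, 0%R, M0) \in K)) => [||j _]; [exact: K0|exact: KD|].
apply: (big_ind (fun M0 => (0%R, 0%R, M0) \in K)) => [||i _]; [exact: K0|exact: KD|].
case: (F2_cases (M j i)) => ->; last first.
  move: (Kz i j); rewrite heis_commg trmx0 mul0mx add0r trmx_delta mul_delta_mx.
  by rewrite scale1r.
by rewrite scale0r; apply: group1.
Qed.

End Subgroup.

Lemma heis_gen :
  <<[set heis_x i | i : 'I_n] :|: [set heis_y i | i : 'I_n]>> = [set: heis n].
Proof.
apply/eqP; rewrite eqEsubset subsetT /=; set K := <<_>>%g.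
have Kx i : heis_x i \in K by rewrite mem_gen // inE imset_f.
have Ky i : heis_y i \in K by rewrite mem_gen // inE imset_f ?orbT.
apply/subsetP=> -[[u v] M] _; rewrite heis_split !groupM //.
- exact: heis_sub_x.
- exact: heis_sub_y.
by apply: heis_sub_z => i j; rewrite groupR.
Qed.

Lemma heis_presented : G_presented heis_x heis_y.
Proof.
split; [exact: heis_relations | exact: heis_gen | move=> K a b rel_ab].
pose liftM := isMultiplicative.Build _ _ _ (heis_liftM rel_ab).
exists (HB.pack_for {multiplicative heis n -> K} (heis_lift a b) liftM).
by split=> i /=; rewrite ?heis_lift_x ?heis_lift_y.
Qed.

End ModelGroup.

(** * Transfer of the model to any group with the presentation *)

Lemma morph_mul1 (G K : groupType) (f : G -> K) :
  {morph f : g h / g * h} -> f 1 = 1.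
Proof. by move=> fM; apply: (mulgI (f 1)); rewrite -fM !mulg1. Qed.

Lemma morph_commg (G K : groupType) (f : G -> K) :
  {morph f : g h / g * h} -> {morph f : g h / [~ g, h]}.
Proof.
by move=> fM g h; apply: (mulgI (f (h * g))); rewrite -fM -commgC !fM -commgC.
Qed.

Lemma eq_multiplicative_gen (gT : finGroupType) (K : groupType) (A : {set gT})
    (f g : gT -> K) :
    {morph f : h k / h * k} -> {morph g : h k / h * k} ->
  <<A>> = [set: gT] -> {in A, f =1 g} -> f =1 g.
Proof.
move=> fM gM genA eq_fg h.
have f1 := morph_mul1 fM.
have g1 := morph_mul1 gM.
have eqG : group_set [set k | f k == g k].
  apply/group_setP; split=> [|k l]; first by rewrite inE f1 g1.
  by rewrite !inE fM gM => /eqP-> /eqP->.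
have: <<A>> \subset Group eqG.
  by rewrite gen_subG; apply/subsetP=> k Ak; rewrite inE eq_fg.
by rewrite genA => /subsetP/(_ h (in_setT h)); rewrite inE => /eqP.
Qed.

Lemma group_set_preim (gT rT : finGroupType) (f : gT -> rT) (X : {group rT}) :
  {morph f : g h / g * h} -> group_set [set h | f h \in X].
Proof.
move=> fM; have f1 := morph_mul1 fM.
apply/group_setP; split=> [|k l]; first by rewrite inE f1 group1.
by rewrite !inE fM; apply: groupM.
Qed.

Section Coordinates.
Variables (n : nat) (gT : finGroupType) (x y : 'I_n -> gT).
Hypothesis pres : G_presented x y.

(** The universal property of [gT] gives a map to the triples, and [heis_lift] gives one back; both
    composites fix the generators, hence are the identity. *)
Lemma presented_coordinates :
  exists2 f : gT -> heis n, bijective f &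
    [/\ {morph f : g h / g * h}, forall i, f (x i) = heis_x i
      & forall i, f (y i) = heis_y i].
Proof.
case: pres => rel_xy gen_xy /(_ _ _ _ (@heis_relations n))[f [fx fy]].
exists f; last by split=> // g h; rewrite gmulfM.
have gM := heis_liftM rel_xy; exists (heis_lift x y) => [h|h].
  apply: (@eq_multiplicative_gen _ _ _ (fun k => heis_lift x y (f k)) id
    _ _ gen_xy) => // [g k|g].
    by rewrite gmulfM gM.
  by case/setUP=> /imsetP[i _ ->]; rewrite (fx, fy) (heis_lift_x, heis_lift_y).
apply: (@eq_multiplicative_gen _ _ _ (fun k => f (heis_lift x y k)) id
  _ _ (heis_gen n)) => // [g k|g].
  by rewrite gM gmulfM.
by case/setUP=> /imsetP[i _ ->]; rewrite (heis_lift_x, heis_lift_y).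
Qed.

Variable f : gT -> heis n.
Hypotheses (f_bij : bijective f) (fM : {morph f : g h / g * h})
  (fx : forall i, f (x i) = heis_x i) (fy : forall i, f (y i) = heis_y i).

Let coord_inv :
  exists2 f' : heis n -> gT, cancel f f' & [/\ cancel f' f,
    {morph f' : g h / g * h}, forall i, f' (heis_x i) = x i
    & forall i, f' (heis_y i) = y i].
Proof.
case: f_bij => f' fK f'K; exists f' => //; split=> // [g h|i|i].
- by apply: (can_inj fK); rewrite fM !f'K.
- by rewrite -fx fK.
by rewrite -fy fK.
Qed.

(** With this description and the two that follow, the generators have done their work: the rest
    sees X, Y and N through coordinates only. *)
Lemma mem_coord_x g :
  (g \in <<[set x i | i : 'I_n]>>) = ((f g).1.2 == 0%R) && ((f g).2 == 0%R).
Proof.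
have [f' fK [f'K f'M f'x f'y]] := coord_inv.
pose A : {set heis n} := [set h | (h.1.2 == 0%R) && (h.2 == 0%R)].
have gA : group_set A.
  apply/group_setP; split=> [|[[u v] M] [[u' v'] M']]; rewrite !inE /= ?eqxx //.
  move=> /andP[/eqP-> /eqP->] /andP[/eqP-> /eqP->].
  by rewrite trmx0 mul0mx !addr0 !eqxx.
apply/idP/idP=> [|/andP[/eqP v0 /eqP M0]].
  suff /subsetP s: <<[set x i | i : 'I_n]>> \subset
    Group (group_set_preim (Group gA) fM) by move/s; rewrite !inE.
  rewrite gen_subG; apply/subsetP=> _ /imsetP[i _ ->].
  by rewrite !inE fx !eqxx.
pose B := Group (group_set_preim <<[set x i | i : 'I_n]>> f'M).
have: f g \in B.
  rewrite [f g]surjective_pairing [(f g).1]surjective_pairing v0 M0.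
  by apply: heis_sub_x => i; rewrite inE f'x mem_gen // imset_f.
by rewrite inE fK.
Qed.

Lemma mem_coord_y g :
  (g \in <<[set y i | i : 'I_n]>>) = ((f g).1.1 == 0%R) && ((f g).2 == 0%R).
Proof.
have [f' fK [f'K f'M f'x f'y]] := coord_inv.
pose A : {set heis n} := [set h | (h.1.1 == 0%R) && (h.2 == 0%R)].
have gA : group_set A.
  apply/group_setP; split=> [|[[u v] M] [[u' v'] M']]; rewrite !inE /= ?eqxx //.
  move=> /andP[/eqP-> /eqP->] /andP[/eqP-> /eqP->].
  by rewrite mulmx0 !addr0 !eqxx.
apply/idP/idP=> [|/andP[/eqP v0 /eqP M0]].
  suff /subsetP s: <<[set y i | i : 'I_n]>> \subset
    Group (group_set_preim (Group gA) fM) by move/s; rewrite !inE.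
  rewrite gen_subG; apply/subsetP=> _ /imsetP[i _ ->].
  by rewrite !inE fy !eqxx.
pose B := Group (group_set_preim <<[set y i | i : 'I_n]>> f'M).
have: f g \in B.
  rewrite [f g]surjective_pairing [(f g).1]surjective_pairing v0 M0.
  by apply: heis_sub_y => i; rewrite inE f'y mem_gen // imset_f.
by rewrite inE fK.
Qed.

Lemma mem_coord_z g :
  (g \in <<[set [~ x i, y j] | i : 'I_n, j : 'I_n]>>)
    = ((f g).1.1 == 0%R) && ((f g).1.2 == 0%R).
Proof.
have [f' fK [f'K f'M f'x f'y]] := coord_inv.
pose A : {set heis n} := [set h | (h.1.1 == 0%R) && (h.1.2 == 0%R)].
have gA : group_set A.
  apply/group_setP; split=> [|[[u v] M] [[u' v'] M']]; rewrite !inE /= ?eqxx //.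
  move=> /andP[/eqP-> /eqP->] /andP[/eqP-> /eqP->].
  by rewrite !addr0 !eqxx.
set Z := [set [~ x i, y j] | i : 'I_n, j : 'I_n].
apply/idP/idP=> [|/andP[/eqP v0 /eqP M0]].
  suff /subsetP s: <<Z>> \subset
    Group (group_set_preim (Group gA) fM) by move/s; rewrite !inE.
  rewrite gen_subG; apply/subsetP=> _ /imset2P[i j _ _ ->].
  by rewrite !inE (morph_commg fM) fx fy heis_commg !eqxx.
pose B := Group (group_set_preim <<Z>> f'M).
have: f g \in B.
  rewrite [f g]surjective_pairing [(f g).1]surjective_pairing v0 M0.
  apply: heis_sub_z => i j; rewrite inE -fx -fy -(morph_commg fM) fK mem_gen //.
  exact: imset2_f.
by rewrite inE fK.
Qed.

End Coordinates.
(** * Structure and automorphisms *)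

Section Structure.
Variables (n : nat) (gT : finGroupType) (f : gT -> heis n) (mk : heis n -> gT).
Hypotheses (fK : cancel f mk) (mkK : cancel mk f)
  (fM : {morph f : g h / g * h}).

Let mkM : {morph mk : g h / g * h}.
Proof. by move=> g h; apply: (can_inj fK); rewrite fM !mkK. Qed.

Let f1 : f 1 = 1 := morph_mul1 fM.

Let fR g h : f [~ g, h] = [~ f g, f h].
Proof. exact: morph_commg. Qed.

Variables X Y N : {group gT}.
Hypotheses
  (memX : forall g, (g \in X) = ((f g).1.2 == 0%R) && ((f g).2 == 0%R))
  (memY : forall g, (g \in Y) = ((f g).1.1 == 0%R) && ((f g).2 == 0%R))
  (memN : forall g, (g \in N) = ((f g).1.1 == 0%R) && ((f g).1.2 == 0%R)).

Lemma card_rowF2 m k : #|[set: 'M['F_2]_(m, k)]| = (2 ^ (m * k))%N.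
Proof. by rewrite cardsT card_mx card_Fp. Qed.

Lemma card_coord : #|[set: gT]| = (2 ^ (n ^ 2 + 2 * n))%N.
Proof.
have <-: #|[set: heis n]| = #|[set: gT]|.
  by rewrite !cardsT; apply: bij_eq_card; exists f.
rewrite cardsT !card_prod !card_mx card_Fp // -!expnD; congr (_ ^ _)%N.
by rewrite mul1n addnC addnn -mul2n.
Qed.

Lemma coordX g : g \in X -> f g = ((f g).1.1, 0%R, 0%R).
Proof. by rewrite memX; case: (f g) => [[u v] M] /= /andP[/eqP-> /eqP->]. Qed.

Lemma coordY g : g \in Y -> f g = (0%R, (f g).1.2, 0%R).
Proof. by rewrite memY; case: (f g) => [[u v] M] /= /andP[/eqP-> /eqP->]. Qed.

Lemma coordN g : g \in N -> f g = (0%R, 0%R, (f g).2).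
Proof. by rewrite memN; case: (f g) => [[u v] M] /= /andP[/eqP-> /eqP->]. Qed.

Lemma mkX u : mk (u, 0%R, 0%R) \in X. Proof. by rewrite memX mkK /= !eqxx. Qed.
Lemma mkY v : mk (0%R, v, 0%R) \in Y. Proof. by rewrite memY mkK /= !eqxx. Qed.
Lemma mkN M : mk (0%R, 0%R, M) \in N. Proof. by rewrite memN mkK /= !eqxx. Qed.

Lemma cardX_coord : #|X| = (2 ^ n)%N.
Proof.
have <-: [set mk (u, 0%R, 0%R) | u : 'rV['F_2]_n] = X.
  apply/setP=> g; apply/imsetP/idP=> [[u _ ->] | /coordX fg]; first exact: mkX.
  by exists (f g).1.1; rewrite // -fg fK.
by rewrite card_imset => [|u v /(can_inj mkK)[]] //; rewrite -cardsT card_rowF2 mul1n.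
Qed.

Lemma cardY_coord : #|Y| = (2 ^ n)%N.
Proof.
have <-: [set mk (0%R, v, 0%R) | v : 'rV['F_2]_n] = Y.
  apply/setP=> g; apply/imsetP/idP=> [[u _ ->] | /coordY fg]; first exact: mkY.
  by exists (f g).1.2; rewrite // -fg fK.
by rewrite card_imset => [|u v /(can_inj mkK)[]] //; rewrite -cardsT card_rowF2 mul1n.
Qed.

Lemma cardN_coord : #|N| = (2 ^ (n ^ 2))%N.
Proof.
have <-: [set mk (0%R, 0%R, M) | M : 'M['F_2]_n] = N.
  apply/setP=> g; apply/imsetP/idP=> [[u _ ->] | /coordN fg]; first exact: mkN.
  by exists (f g).2; rewrite // -fg fK.
by rewrite card_imset => [|u v /(can_inj mkK)[]] //; rewrite -cardsT card_rowF2.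
Qed.

Lemma coord_XYN g : exists a b c, [/\ a \in X, b \in Y, c \in N & g = a * b * c].
Proof.
exists (mk ((f g).1.1, 0%R, 0%R)), (mk (0%R, (f g).1.2, 0%R)),
  (mk (0%R, 0%R, (f g).2)); split; [exact: mkX | exact: mkY | exact: mkN |].
apply: (can_inj fK); rewrite !fM !mkK -heis_split.
by case: (f g) => [[]].
Qed.

Lemma coord_TI : X :&: Y = 1.
Proof.
apply/trivgP/subsetP=> g; rewrite !inE => /andP[/coordX fg].
rewrite memY fg /= => /andP[/eqP u0 _]; rewrite u0 in fg.
by apply/eqP/(can_inj fK); rewrite f1.
Qed.

Lemma coord_sqr g : g \in X \/ g \in Y \/ g \in N -> g * g = 1.
Proof.
move=> Dg; apply: (can_inj fK); rewrite fM f1.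
by case: Dg => [/coordX-> | [/coordY-> | /coordN->]];
  rewrite heis_mulE ?trmx0 ?mul0mx ?mulmx0 !F2_addvv ?addr0.
Qed.

Lemma coord_abelem (A : {group gT}) :
  A \subset X \/ A \subset Y \/ A \subset N -> 2.-abelem A.
Proof.
move=> sA; have inv g : g \in A -> g * g = 1.
  by move=> Ag; apply: coord_sqr; case: sA => [|[]] /subsetP/(_ g Ag); auto.
have invV g : g \in A -> g^-1 = g.
  by move=> Ag; apply: (mulgI g); rewrite mulgV inv.
apply/abelemP => //; split=> [|g Ag]; last by rewrite expg2 inv.
apply/centsP=> g Ag h Ah; rewrite /commute -[LHS]invV ?groupM // invMg.
by rewrite !invV.
Qed.

Lemma coord_central : N \subset 'Z([set: gT]).
Proof.
apply/subsetP=> z Nz; apply/centerP; split=> // g _; apply: (can_inj fK).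
rewrite !fM (coordN Nz); case: (f g) => [[u v] M].
by rewrite !heis_mulE trmx0 mul0mx mulmx0 !addr0 !add0r (addrC M).
Qed.

Lemma coord_der : [set: gT]^`(1) = N.
Proof.
apply/eqP; rewrite eqEsubset gen_subG; apply/andP; split.
  apply/subsetP=> _ /imset2P[g h _ _ ->]; rewrite memN fR.
  by case: (f g) (f h) => [[u v] M] [[u' v'] M']; rewrite heis_commg /= !eqxx.
apply/subsetP=> z /coordN fz; rewrite -[z]fK fz.
pose fK' := Group (group_set_preim [set: gT]^`(1) mkM).
suff: (0%R, 0%R, (f z).2) \in fK' by rewrite inE.
apply: heis_sub_z => i j; rewrite inE.
suff ->: mk [~ heis_x i, heis_y j] = [~ mk (heis_x i), mk (heis_y j)].
  by rewrite mem_commg.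
by apply: (can_inj fK); rewrite fR !mkK.
Qed.

Lemma coord_gen : <<X :|: Y>> = [set: gT].
Proof.
apply/eqP; rewrite eqEsubset subsetT /=; apply/subsetP=> g _.
have [a [b [c [Xa Yb Nc ->]]]] := coord_XYN g.
have sX : X \subset <<X :|: Y>> by rewrite sub_gen ?subsetUl.
have sY : Y \subset <<X :|: Y>> by rewrite sub_gen ?subsetUr.
rewrite !groupM ?(subsetP sX a) ?(subsetP sY b) //.
rewrite -(fK c) (coordN Nc).
suff: (0%R, 0%R, (f c).2) \in Group (group_set_preim <<X :|: Y>> mkM) by rewrite inE.
apply: heis_sub_z => i j; rewrite groupR // inE.
  exact/(subsetP sX)/mkX.
exact/(subsetP sY)/mkY.
Qed.

End Structure.

(** * Linear algebra over the field with two elements *)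

Lemma F2_row_transitive (n : nat) (u u' : 'rV['F_2]_n) :
  u != 0%R -> u' != 0%R -> exists2 A, A \in unitmx & (u *m A)%R = u'.
Proof.
(* A nonzero row has rank one, and its 1 x 1 column base, a unit of F_2, is 1. So the row is the
   first row of an invertible matrix. *)
have ebase (w : 'rV['F_2]_n) : w != 0%R -> w = (pid_mx 1 *m row_ebase w)%R.
  move=> w_nz; rewrite -{1}(mulmx_ebase w) (_ : \rank w = 1%N); last first.
    by apply/eqP; rewrite eqn_leq rank_leq_row lt0n mxrank_eq0.
  rewrite [col_ebase w]mx11_scalar; case: (F2_cases (col_ebase w 0%R 0%R)) => e.
    have := col_ebase_unit w; rewrite unitmxE det_mx11 e.
    by rewrite unitr0.
  by rewrite e mul1mx.
move=> /ebase u_e /ebase u'_e.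
exists (invmx (row_ebase u) *m row_ebase u')%R.
  by rewrite unitmx_mul unitmx_inv !row_ebase_unit.
by rewrite {1}u_e mulmxA mulmxK ?row_ebase_unit // -u'_e.
Qed.

Section TensorIdentities.
Variable n : nat.

(** Over F_2 the hypotheses say that b' is not a multiple of b, so some functional kills b and not
    b'. It is built from a coordinate k where the two differ, corrected if b'_k = 0 by a coordinate
    l with b'_l = 1. *)
Lemma F2_separate (b b' : 'rV['F_2]_n) : b != b' -> b' != 0%R ->
  exists c : 'cV['F_2]_n, (b *m c = 0)%R /\ (b' *m c = 1)%R.
Proof.
move=> neq_b b'n.
have col (w : 'rV['F_2]_n) k : (w *m delta_mx k 0%R)%R = ((w 0 k)%:M)%R.
  by rewrite -colE; apply/matrixP=> i j; rewrite !ord1 !mxE eqxx.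
have [k bk] : exists k, b 0%R k != b' 0%R k.
  apply/existsP; apply: contraR neq_b; rewrite negb_exists => /forallP eqb.
  by apply/eqP/rowP=> k; apply/eqP; have := eqb k; rewrite negbK.
case: (F2_cases (b' 0%R k)) bk => b'k; rewrite b'k; last first.
  case: (F2_cases (b 0%R k)) => bk; rewrite bk ?eqxx // => _.
  by exists (delta_mx k 0%R); rewrite !col bk b'k raddf0.
case: (F2_cases (b 0%R k)) => bk; rewrite bk ?eqxx // => _.
case/rV0Pn: b'n => l; case: (F2_cases (b' 0%R l)) => b'l; rewrite b'l ?eqxx // => _.
case: (F2_cases (b 0%R l)) => bl.
  by exists (delta_mx l 0%R); rewrite !col bl b'l raddf0.
exists (delta_mx k 0%R + delta_mx l 0%R)%R; rewrite !mulmxDr !col.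
by rewrite bk bl b'k b'l F2_addvv raddf0 add0r.
Qed.

(** A nonzero rank one matrix determines its two factors up to a scalar and its inverse, and 1 is
    the only nonzero scalar of F_2. *)
Lemma F2_tensor_inj (u u' v v' : 'rV['F_2]_n) :
    u != 0%R -> v != 0%R -> u' != 0%R -> v' != 0%R ->
  (v^T *m u = v'^T *m u')%R -> u = u' /\ v = v'.
Proof.
move=> /rV0Pn[i ui] /rV0Pn[j vj] /rV0Pn[i' ui'] /rV0Pn[j' vj'] /matrixP e.
have nz (s : 'F_2) : s != 0%R -> s = 1%R by case: (F2_cases s) => -> //.
have {}e k l : (v 0%R k * u 0%R l)%R = (v' 0%R k * u' 0%R l)%R.
  by have := e k l; rewrite !mxE !big_ord1 !mxE.
have v'j : v' 0%R j = 1%R.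
  have := e j i; rewrite (nz _ ui) (nz _ vj) mulr1.
  case: (F2_cases (v' 0%R j)) => // ->.
  by rewrite mul0r.
have u'i : u' 0%R i = 1%R.
  have := e j i; rewrite (nz _ ui) (nz _ vj) mulr1.
  case: (F2_cases (u' 0%R i)) => // ->.
  by rewrite mulr0.
split; apply/rowP=> k.
  by have := e j k; rewrite (nz _ vj) v'j !mul1r.
by have := e k i; rewrite (nz _ ui) u'i !mulr1.
Qed.

(* The left-hand side is the matrix component of the product of the (a_i, 0, 0)
   and (0, b_i, 0), for i = 1, ..., 4, once the a_i and the b_i sum to 0. *)
Lemma F2_tensor3 (a1 a3 a4 b1 b2 b3 : 'rV['F_2]_n) :
    a1 != 0%R -> a3 != 0%R -> a4 != 0%R ->
    b1 != 0%R -> b2 != 0%R -> b3 != 0%R ->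
    (b1^T *m a1 + b2^T *m (a3 + a4) + b3^T *m a4 = 0)%R ->
  [/\ a1 = a3, b1 = b3 & b1 = b2 \/ a1 = a4].
Proof.
move=> a1n a3n a4n b1n b2n b3n e.
have eq_of m k (P Q : 'M['F_2]_(m, k)) : (P + Q = 0)%R -> P = Q.
  by move/eqP; rewrite addr_eq0 F2_oppv => /eqP.
have [eb | nb] := eqVneq b1 b2.
  move: e; rewrite -eb -mulmxDr => /eq_of e; have a13 : a1 = a3.
    have [w0 | wn] := eqVneq (a1 + (a3 + a4))%R 0%R.
      move: e; rewrite w0 mulmx0 => /esym e.
      case/rV0Pn: a4n => i ai; case/rV0Pn: b3n => j bj.
      have /matrixP/(_ j i) := e; rewrite !mxE big_ord1 !mxE => /eqP.
      by rewrite mulf_eq0 (negPf ai) (negPf bj).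
    have [ea _] := F2_tensor_inj wn b1n a4n b3n e.
    by apply: eq_of; apply: (addIr a4); rewrite -addrA ea add0r.
  split=> //; last by left.
  move: e; rewrite -a13 addrA F2_addvv add0r => e.
  by case: (F2_tensor_inj a4n b1n a4n b3n e).
have [c [b1c b2c]] : exists c : 'cV['F_2]_n, (b1 *m c = 0)%R /\ (b2 *m c = 1)%R.
  exact: F2_separate nb b2n.
(* Contraction with c kills the first term and strips b2 from the second. The scalar b3 c cannot be
   1, since a3 is nonzero; hence a3 = a4. *)
have ec : ((a3 + a4) + (b3 *m c)^T *m a4 = 0)%R.
  have: (c^T *m (b1^T *m a1 + b2^T *m (a3 + a4) + b3^T *m a4) = 0)%R.
    by rewrite e mulmx0.
  rewrite !mulmxDr !mulmxA -!trmx_mul b1c b2c trmx0 trmx1 mul0mx !mul1mx.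
  by rewrite add0r.
have w0 : (a3 + a4 = 0)%R.
  move: ec; rewrite [(b3 *m c)%R]mx11_scalar tr_scalar_mx.
  case: (F2_cases ((b3 *m c)%R 0%R 0%R)) => ->.
    by rewrite raddf0 mul0mx addr0.
  rewrite mul1mx -addrA F2_addvv addr0 => a30; by rewrite a30 eqxx in a3n.
move: e; rewrite w0 mulmx0 addr0 => /eq_of e.
have [ea eb] := F2_tensor_inj a1n b1n a4n b3n e.
split=> //; last by right.
by rewrite ea; apply/esym/eq_of.
Qed.

End TensorIdentities.

(** * Automorphisms of the model *)

Section ModelAutomorphisms.
Variable n : nat.

(** Base change by A on the x-part and by B on the y-part; the matrix part has to transform as the
    tensors v^T u do. *)
Definition heis_lin (A B : 'M['F_2]_n) (g : heis n) : heis n :=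
  (g.1.1 *m A, g.1.2 *m B, B^T *m g.2 *m A)%R.

Lemma heis_linM A B : {morph heis_lin A B : g h / g * h}.
Proof.
case=> [[u v] M] [[u' v'] M']; rewrite /heis_lin /= !heis_mulE.
congr (_, _, _); rewrite ?mulmxDl // !mulmxDr !mulmxDl trmx_mul.
by rewrite !mulmxA.
Qed.

Lemma heis_lin_inj A B :
  A \in unitmx -> B \in unitmx -> injective (heis_lin A B).
Proof.
move=> uA uB [[u v] M] [[u' v'] M'] [eu ev eM].
congr (_, _, _); first exact: (can_inj (mulmxK uA)).
  exact: (can_inj (mulmxK uB)).
have uBt : (B^T)%R \in unitmx by rewrite unitmx_tr.
exact/(can_inj (mulKmx uBt))/(can_inj (mulmxK uA)).
Qed.

Lemma heis_lin_M0 (A B M : 'M['F_2]_n) : A \in unitmx -> B \in unitmx ->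
  ((B^T *m M *m A)%R == 0%R) = (M == 0%R).
Proof.
move=> uA uB; apply/eqP/eqP=> [e|->]; last by rewrite mulmx0 mul0mx.
have uBt : (B^T)%R \in unitmx by rewrite unitmx_tr.
apply/(can_inj (mulKmx uBt))/(can_inj (mulmxK uA)).
by rewrite e mulmx0 mul0mx.
Qed.

Lemma heis_lin_u0 (A : 'M['F_2]_n) (u : 'rV['F_2]_n) : A \in unitmx ->
  ((u *m A)%R == 0%R) = (u == 0%R).
Proof.
move=> uA; apply/eqP/eqP=> [e|->]; last by rewrite mul0mx.
by apply/(can_inj (mulmxK uA)); rewrite e mul0mx.
Qed.

(** Exchanging x_i with y_i sends [x_i, y_j] to [y_i, x_j] = [x_j, y_i], which transposes M. It also
    puts the y-part before the x-part, and restoring the order costs u^T v. *)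
Definition heis_swap (g : heis n) : heis n :=
  (g.1.2, g.1.1, (g.2^T + g.1.1^T *m g.1.2)%R).

Lemma heis_swapM : {morph heis_swap : g h / g * h}.
Proof.
case=> [[u v] M] [[u' v'] M']; rewrite /heis_swap /= !heis_mulE.
congr (_, _, _); rewrite [(_ + _ *m _)^T%R]linearD /= trmx_mul trmxK.
rewrite [(M + M')^T%R]linearD [(u + u')^T%R]linearD /=.
rewrite mulmxDr !mulmxDl !addrA.
by rewrite [LHS](ACl (1*4*2*7*6*(3*5))%AC) /= F2_addvv addr0.
Qed.

Lemma heis_swapK : involutive heis_swap.
Proof.
case=> [[u v] M]; rewrite /heis_swap /=; congr (_, _, _).
by rewrite linearD /= trmx_mul !trmxK -addrA F2_addvv addr0.
Qed.

End ModelAutomorphisms.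

Section CoordinateAutomorphisms.
Variables (n : nat) (gT : finGroupType) (f : gT -> heis n) (mk : heis n -> gT).
Hypotheses (fK : cancel f mk) (mkK : cancel mk f)
  (fM : {morph f : g h / g * h}).

Let mkM : {morph mk : g h / g * h}.
Proof. by move=> g h; apply: (can_inj fK); rewrite fM !mkK. Qed.

Let f1 : f 1 = 1 := morph_mul1 fM.

Variables X Y : {group gT}.
Hypotheses
  (memX : forall g, (g \in X) = ((f g).1.2 == 0%R) && ((f g).2 == 0%R))
  (memY : forall g, (g \in Y) = ((f g).1.1 == 0%R) && ((f g).2 == 0%R)).

Lemma coord_aut_transitive x x' y y' :
    x \in X^# -> x' \in X^# -> y \in Y^# -> y' \in Y^# ->
  exists2 alpha : gT -> gT,
    [/\ {morph alpha : g h / g * h}, injective alpha,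
        {mono alpha : g / g \in X} & {mono alpha : g / g \in Y}] &
    alpha x = x' /\ alpha y = y'.
Proof.
have Xnz g : g \in X^# -> exists2 u, u != 0%R & f g = (u, 0%R, 0%R).
  case/setD1P=> g1 /(coordX memX) fg; exists (f g).1.1 => //.
  by apply: contra g1 => /eqP u0; rewrite -(inj_eq (can_inj fK)) f1 fg u0.
have Ynz g : g \in Y^# -> exists2 v, v != 0%R & f g = (0%R, v, 0%R).
  case/setD1P=> g1 /(coordY memY) fg; exists (f g).1.2 => //.
  by apply: contra g1 => /eqP u0; rewrite -(inj_eq (can_inj fK)) f1 fg u0.
move=> /Xnz[u u0 fx] /Xnz[u' u'0 fx'] /Ynz[v v0 fy] /Ynz[v' v'0 fy'].
have [A uA uAu'] := F2_row_transitive u0 u'0.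
have [B uB vBv'] := F2_row_transitive v0 v'0.
exists (fun g => mk (heis_lin A B (f g))).
  split=> [g h|g h|g|g].
  - by rewrite fM heis_linM mkM.
  - by move/(can_inj mkK)/(heis_lin_inj uA uB)/(can_inj fK).
  - by rewrite !memX mkK /= heis_lin_u0 ?heis_lin_M0.
  by rewrite !memY mkK /= heis_lin_u0 ?heis_lin_M0.
split; apply: (can_inj fK); rewrite mkK /heis_lin.
  by rewrite fx fx' /= uAu' mul0mx mulmx0 mul0mx.
by rewrite fy fy' /= vBv' mul0mx mulmx0 mul0mx.
Qed.

Lemma coord_swap :
  exists2 sigma : gT -> gT,
    {morph sigma : g h / g * h} /\ involutive sigma &
    forall g, (sigma g \in X) = (g \in Y) /\ (sigma g \in Y) = (g \in X).
Proof.
exists (fun g => mk (heis_swap (f g))).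
  by split=> [g h|g]; rewrite ?fM ?heis_swapM ?mkM // mkK heis_swapK fK.
move=> g; rewrite !memX !memY mkK /heis_swap /=; case: (f g) => [[u v] M] /=.
have tr0 : ((M^T)%R == 0%R) = (M == 0%R) by rewrite -{1}trmx0 (inj_eq trmx_inj).
split; [case: (altP (u =P _)) | case: (altP (v =P _))] => //= ->.
  by rewrite trmx0 mul0mx addr0.
by rewrite mulmx0 addr0.
Qed.

End CoordinateAutomorphisms.
(** * Rigidity of octagons *)

Section AlternatingWords.
Variable gT : finGroupType.

Definition octagon_rigid (X Y : {group gT}) : Prop :=
  forall x1 y1 x2 y2 x3 y3 x4 y4 : gT,
    [/\ x1 \in X^#, x2 \in X^#, x3 \in X^# & x4 \in X^#] ->
    [/\ y1 \in Y^#, y2 \in Y^#, y3 \in Y^# & y4 \in Y^#] ->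
    x1 * y1 * x2 * y2 * x3 * y3 * x4 * y4 = 1 ->
  [/\ x1 = x3, x2 = x4, y1 = y3, y2 = y4 & x1 = x2 \/ y1 = y2].

(** All that the rigidity argument uses of the two subgroups. The fourth clause supplies octagons,
    the fifth a second nontrivial letter. The definition is not symmetric, so that it is established
    for both orders of X and Y. *)
Definition octagon_pair (X Y : {group gT}) : Prop :=
  [/\ X :&: Y = 1, forall x, x \in X -> x * x = 1, octagon_rigid X Y,
      {in X & Y &, forall x y y', x * y * x * y' * x * y * x * y' = 1}
    & forall y, y \in Y -> exists2 y', y' \in Y^# & y' != y].

Lemma mulg_rot (g h : gT) : g * h = 1 -> h * g = 1.
Proof. by move/eqP; rewrite mulg_eq1 => /eqP->; rewrite mulgV. Qed.

(** Moving the first letter to the end makes the word start in the other subgroup; the conclusion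
    survives the shift of indices because y3 = y1. *)
Lemma octagon_rigidC X Y : octagon_rigid X Y -> octagon_rigid Y X.
Proof.
move=> rig y1 x1 y2 x2 y3 x3 y4 x4 [Y1 Y2 Y3 Y4] [X1 X2 X3 X4].
rewrite -!mulgA => /mulg_rot; rewrite !mulgA => e.
have [|//|-> -> -> <- [->|->]] := rig _ _ _ _ _ _ _ _ _ _ e; first by split.
  by split=> //; auto.
by split=> //; auto.
Qed.

End AlternatingWords.

Section CoordinateWords.
Variables (n : nat) (gT : finGroupType) (f : gT -> heis n) (mk : heis n -> gT).
Hypotheses (fK : cancel f mk) (mkK : cancel mk f)
  (fM : {morph f : g h / g * h}).

Let f1 : f 1 = 1 := morph_mul1 fM.

Variables X Y : {group gT}.
Hypotheses
  (memX : forall g, (g \in X) = ((f g).1.2 == 0%R) && ((f g).2 == 0%R))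
  (memY : forall g, (g \in Y) = ((f g).1.1 == 0%R) && ((f g).2 == 0%R)).

Let Xnz g : g \in X^# -> exists2 u, u != 0%R & f g = (u, 0%R, 0%R).
Proof.
case/setD1P=> g1 /(coordX memX) fg; exists (f g).1.1 => //.
by apply: contra g1 => /eqP u0; rewrite -(inj_eq (can_inj fK)) f1 fg u0.
Qed.

Let Ynz g : g \in Y^# -> exists2 v, v != 0%R & f g = (0%R, v, 0%R).
Proof.
case/setD1P=> g1 /(coordY memY) fg; exists (f g).1.2 => //.
by apply: contra g1 => /eqP u0; rewrite -(inj_eq (can_inj fK)) f1 fg u0.
Qed.

Let mul_simp :=
  (heis_mulE, (@mulmx0, @mul0mx), (@trmx0), (@addr0, @add0r)).

Lemma coord_octagon : octagon_rigid X Y.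
Proof.
move=> x1 y1 x2 y2 x3 y3 x4 y4.
case=> /Xnz[a1 a1n e1] /Xnz[a2 a2n e2] /Xnz[a3 a3n e3] /Xnz[a4 a4n e4].
case=> /Ynz[b1 b1n k1] /Ynz[b2 b2n k2] /Ynz[b3 b3n k3] /Ynz[b4 b4n k4].
move/(congr1 f); rewrite f1 !fM e1 e2 e3 e4 k1 k2 k3 k4.
rewrite !mul_simp => -[ea eb eM].
have sum0 (p q : 'rV['F_2]_n) : (p + q = 0)%R -> p = q.
  by move/eqP; rewrite addr_eq0 F2_oppv => /eqP.
(* The matrix component of the word is the sum of b_i^T a_j over i < j. Replacing a2 + a3 + a4 by a1
   brings it to the three terms of [F2_tensor3]. *)
have ea1 : a1 = (a2 + a3 + a4)%R by apply: sum0; rewrite !addrA.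
have [||//|//|//|//||a13 b13 ab] := @F2_tensor3 _ a1 a3 a4 b1 b2 b3 => //.
  rewrite -[RHS]eM {1}ea1 !linearD /= !mulmxDl !addrA.
  by rewrite [RHS](ACl (1*2*4*3*5*6)%AC).
have sum13 (p q r t : 'rV['F_2]_n) : (p + q + r + t = 0)%R -> p = r -> q = t.
  move=> + pr; rewrite pr [(_ + t)%R](ACl ((1*3)*(2*4))%AC) /= F2_addvv add0r.
  exact: sum0.
have a24 := sum13 _ _ _ _ ea a13; have b24 := sum13 _ _ _ _ eb b13.
split.
- by apply: (can_inj fK); rewrite e1 e3 a13.
- by apply: (can_inj fK); rewrite e2 e4 a24.
- by apply: (can_inj fK); rewrite k1 k3 b13.
- by apply: (can_inj fK); rewrite k2 k4 b24.
by case: ab => [b12|a14]; [right|left]; apply: (can_inj fK);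
  rewrite ?k1 ?k2 ?b12 // e1 e2 a24 a14.
Qed.

Let sqr0 g : (f g).1.1 = 0%R \/ (f g).1.2 = 0%R -> g * g = 1.
Proof.
move=> g0; apply: (can_inj fK); rewrite fM f1; move: g0.
by case: (f g) => [[u v] M] /= [] ->;
  rewrite heis_mulE ?trmx0 ?mul0mx ?mulmx0 !F2_addvv ?addr0.
Qed.

(** The word is the square of x y x y', whose x-coordinate is zero, and the square of such an
    element is trivial. *)
Lemma coord_octagons : {in X & Y &, forall x y y',
  x * y * x * y' * x * y * x * y' = 1}.
Proof.
move=> x y y' Xx Yy Yy'.
have -> : x * y * x * y' * x * y * x * y' = (x * y * x * y') * (x * y * x * y').
  by rewrite !mulgA.
apply: sqr0; left; rewrite !fM /= (coordY memY Yy) (coordY memY Yy') /=.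
by rewrite !addr0 F2_addvv.
Qed.

Lemma coord_octagonsC : {in Y & X &, forall y x x',
  y * x * y * x' * y * x * y * x' = 1}.
Proof.
move=> y x x' Yy Xx Xx'.
have -> : y * x * y * x' * y * x * y * x' = (y * x * y * x') * (y * x * y * x').
  by rewrite !mulgA.
apply: sqr0; right; rewrite !fM /= (coordX memX Xx) (coordX memX Xx') /=.
by rewrite !addr0 F2_addvv.
Qed.

End CoordinateWords.

(** * Edge labels under an injective map *)

Lemma gen_ind (gT : finGroupType) (A : {set gT}) (Q : gT -> Prop) :
    <<A>> = [set: gT] -> Q 1 -> (forall a g, a \in A -> Q g -> Q (a * g)) ->
  forall g, Q g.
Proof.
move=> genA Q1 QM g; have /gen_prodgP[n [c Ac ->]]: g \in <<A>> by rewrite genA inE.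
elim: n c Ac => [|n IHn] c Ac; first by rewrite big_ord0.
by rewrite big_ord_recl; apply: QM => //; apply: IHn.
Qed.

Section EdgeLabels.
Variables (gT : finGroupType) (s : gT -> gT).
Hypothesis s_inj : injective s.

(** A cocycle, with [edge_labelM] as its cocycle identity. It is constant in h exactly when s is a
    homomorphism followed by a right translation. *)
Definition edge_label h g := s (g * h) * (s h)^-1.

Definition keeps_label_type (X Y : {group gT}) : Prop :=
  forall h, {in X, forall x, edge_label h x \in X}
    /\ {in Y, forall y, edge_label h y \in Y}.

Lemma edge_label1 h : edge_label h 1 = 1.
Proof. by rewrite /edge_label mul1g mulgV. Qed.

Lemma edge_labelM h g k :
  edge_label h (k * g) = edge_label (g * h) k * edge_label h g.
Proof. by rewrite /edge_label !mulgA mulgVK. Qed.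

Lemma edge_label_inj h : injective (edge_label h).
Proof. by move=> g k /mulIg/s_inj/mulIg. Qed.

(** Going along the edge from h to x h and back gives two labels with product 1, and a label in X is
    its own inverse. *)
Lemma edge_label_invol (X Y : {group gT}) h x : octagon_pair X Y ->
  keeps_label_type X Y -> x \in X -> edge_label (x * h) x = edge_label h x.
Proof.
case=> _ inv _ _ _ kl Xx; apply: (mulIg (edge_label h x)).
by rewrite -edge_labelM !inv ?edge_label1 //; case: (kl h) => ->.
Qed.

(** The word, read from right to left, is the closed walk h, h1, ..., h7, h. Its image is again
    closed and alternating, with nontrivial labels, so rigidity applies to the labels. *)
Lemma edge_label_octagon (X Y : {group gT}) h y1 x1 y2 x2 y3 x3 y4 x4 :
    octagon_pair X Y -> keeps_label_type X Y ->
    [/\ x1 \in X^#, x2 \in X^#, x3 \in X^# & x4 \in X^#] ->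
    [/\ y1 \in Y^#, y2 \in Y^#, y3 \in Y^# & y4 \in Y^#] ->
    x4 * y4 * x3 * y3 * x2 * y2 * x1 * y1 = 1 ->
  let h1 := y1 * h in let h2 := x1 * h1 in let h3 := y2 * h2 in
  let h4 := x2 * h3 in let h5 := y3 * h4 in let h6 := x3 * h5 in
  let h7 := y4 * h6 in
  [/\ edge_label h1 x1 = edge_label h5 x3, edge_label h2 y2 = edge_label h6 y4
    & edge_label h1 x1 = edge_label h3 x2 \/ edge_label h2 y2 = edge_label h4 y3].
Proof.
move=> oct kl X4 Y4 w1 h1 h2 h3 h4 h5 h6 h7.
have kX k x : x \in X^# -> edge_label k x \in X^#.
  case/setD1P=> x1' Xx; rewrite !inE; case: (kl k) => -> // _; rewrite andbT.
  by rewrite -(edge_label1 k) (inj_eq (@edge_label_inj k)).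
have kY k y : y \in Y^# -> edge_label k y \in Y^#.
  case/setD1P=> y1' Yy; rewrite !inE; case: (kl k) => _ -> //; rewrite andbT.
  by rewrite -(edge_label1 k) (inj_eq (@edge_label_inj k)).
case: X4 Y4 => X1 X2 X3 X4 [Y1 Y2 Y3 Y4].
have: edge_label h7 x4 * edge_label h6 y4 * edge_label h5 x3 * edge_label h4 y3
    * edge_label h3 x2 * edge_label h2 y2 * edge_label h1 x1 * edge_label h y1 = 1.
  by rewrite -(edge_label1 h) -w1 !edge_labelM.
case: oct => _ _ rig _ _ /rig[||e48 e26 e37 _ xy]; try by split; auto.
by split=> //; case: xy => e; [left | right]; rewrite -?e26 -?e37 -?e48.
Qed.

Section Rigidity.
Variables (X Y : {group gT}).
Hypotheses (octXY : octagon_pair X Y) (octYX : octagon_pair Y X)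
  (kl : keeps_label_type X Y).

(* The paths labelled [x, y, x] are those extending to several octagons, so
   automorphisms preserve them. *)
Lemma edge_label_slide h x y :
  x \in X -> y \in Y -> edge_label (y * h) x = edge_label h x.
Proof.
move=> Xx Yy; have [-> | x1] := eqVneq x 1; first by rewrite !edge_label1.
have [-> | y1] := eqVneq y 1; first by rewrite mul1g.
have X1 : x \in X^# by rewrite !inE x1.
have Y1 : y \in Y^# by rewrite !inE y1.
case: (octXY) => _ invX _ sq /(_ y Yy)[y' Y1' neq_y'].
have Yy' : y' \in Y by case/setD1P: Y1'.
have w z : z \in Y -> x * y * x * z * x * y * x * z = 1 by move=> Yz; apply: sq.
pose h1 := x * h.
have e1 : edge_label h1 x = edge_label h x by apply: edge_label_invol octXY kl Xx.
(* The octagon with letters z, x, y, x, z, x, y, x is placed so that it runs through x h, h, y h, x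
   y h. Its alternative gives the claim, or else prescribes the label of z at x y h. *)
have ends z : z \in Y^# ->
    edge_label h1 x = edge_label (y * h) x
    \/ edge_label h y = edge_label (x * (y * h)) z.
  move=> Z1; have Yz : z \in Y by case/setD1P: Z1.
  have := @edge_label_octagon X Y (z^-1 * h1) z x y x z x y x octXY kl.
  rewrite mulKVg /h1 [x * (x * h)]mulgA invX // mul1g.
  by case=> //; apply: w.
(* The two distinct letters y and y' cannot both have the label [edge_label h y] at x y h. *)
case: (ends y Y1) => [<- // | ey].
case: (ends y' Y1') => [<- // | ey'].
by case/eqP: neq_y'; apply: (@edge_label_inj (x * (y * h))); rewrite -ey.
Qed.

(** In the octagon of x' y x y x' y x y the two edges with letter x are opposite, so their labels
    agree. Sliding along y, and reversing one of the edges, moves them to h and to x' h. *)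
Lemma edge_label_slide_same h x x' :
  x \in X -> x' \in X -> edge_label (x' * h) x = edge_label h x.
Proof.
move=> Xx Xx'; have [-> | x1] := eqVneq x 1; first by rewrite !edge_label1.
have [-> | x'1] := eqVneq x' 1; first by rewrite mul1g.
have X1 : x \in X^# by rewrite !inE x1.
have X1' : x' \in X^# by rewrite !inE x'1.
case: (octXY) => _ invX _ _ /(_ 1 (group1 Y))[y Y1 _].
have Yy : y \in Y by case/setD1P: Y1.
have slide k : edge_label (y * k) x = edge_label k x.
  apply: (edge_label_slide _ Xx Yy).
have invol k : edge_label (x * k) x = edge_label k x.
  exact: edge_label_invol octXY kl Xx.
have w : x' * y * x * y * x' * y * x * y = 1.
  case: (octYX) => _ _ _ sq _.
  by have /mulg_rot := sq y x x' Yy Xx Xx'; rewrite !mulgA.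
have := @edge_label_octagon X Y ((y * x * y)^-1 * h) y x y x' y x y x' octXY kl.
case=> // e _ _; move: e; set h1 := y * _.
have eh : y * (x * h1) = h by rewrite /h1 !invMg !mulgA !mulgK mulgV mul1g.
by rewrite slide eh -(invol h1) -(slide (x * h1)) eh => ->.
Qed.

End Rigidity.

Lemma keeps_label_typeC X Y : keeps_label_type X Y -> keeps_label_type Y X.
Proof. by move=> kl h; case: (kl h). Qed.

(** The base point moves one generator at a time. The letter of the edge and the letter of the move
    are of equal or of different type, which gives the four cases of the two slide lemmas. *)
Lemma label_type_multiplicative (X Y : {group gT}) :
    octagon_pair X Y -> octagon_pair Y X -> keeps_label_type X Y ->
    <<X :|: Y>> = [set: gT] -> s 1 = 1 ->
  {morph s : g h / g * h}.
Proof.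
move=> octXY octYX kl genXY s1.
have klC := keeps_label_typeC kl.
have slide g k : k \in X :|: Y -> forall h, edge_label (g * h) k = edge_label h k.
  move=> XYk; move: g; apply: (gen_ind genXY) => [h|l g XYl IH h].
    by rewrite mul1g.
  rewrite -mulgA -(IH h); case/setUP: XYk => Ak; case/setUP: XYl => Al.
  - by apply: (edge_label_slide_same octXY octYX kl _ Ak Al).
  - by apply: (edge_label_slide octXY kl _ Ak Al).
  - by apply: (edge_label_slide octYX klC _ Ak Al).
  by apply: (edge_label_slide_same octYX octXY klC _ Ak Al).
have sM k h : k \in X :|: Y -> s (k * h) = s k * s h.
  move=> XYk; have := slide h k XYk 1.
  rewrite /edge_label !mulg1 s1 invg1 mulg1.
  by move/(canRL (mulgVK _)).
apply: (gen_ind genXY) => [h|k g XYk IH h]; first by rewrite s1 !mul1g.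
by rewrite -mulgA (sM k (g * h) XYk) IH mulgA -(sM k g XYk).
Qed.

End EdgeLabels.
(** * The Cayley graph *)

Section Distance.
Variables (T : finType) (e : rel T).

Lemma walk0 u v : walk e 0 u v = (u == v).
Proof.
apply/existsP/idP=> [[p]|uv]; first by rewrite tuple0.
by exists [tuple].
Qed.

Lemma walkS k u v : walk e k.+1 u v = [exists w, e u w && walk e k w v].
Proof.
apply/existsP/existsP=> [[p]|[w /andP[uw /existsP[p /andP[wp lp]]]]].
  case/tupleP: p => w p /= /andP[/andP[uw wp] lp]; exists w; rewrite uw /=.
  by apply/existsP; exists p; rewrite wp.
by exists (cons_tuple w p); rewrite /= uw wp.
Qed.

Lemma walk1 u v : walk e 1 u v = e u v.
Proof.
rewrite walkS; apply/existsP/idP=> [[w /andP[uw]]|uv].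
  by rewrite walk0 => /eqP <-.
by exists v; rewrite uv walk0 eqxx.
Qed.

(** A failed search returns #|T|, so the bound on k certifies that a walk was found. *)
Lemma gdistP u v k : (k < #|T|)%N -> gdist e u v = k ->
  walk e k u v /\ forall j, (j < k)%N -> ~~ walk e j u v.
Proof.
move=> kT; rewrite /gdist => uv.
have Hk : (find (fun k => walk e k u v) (iota 0 #|T|) < #|T|)%N by rewrite uv.
split=> [|j jk].
  have := nth_find 0 (a := fun k => walk e k u v) (s := iota 0 #|T|).
  rewrite has_find size_iota => /(_ Hk); rewrite nth_iota // uv add0n //.
have jk' : (j < find (fun k => walk e k u v) (iota 0 #|T|))%N by rewrite uv.
have := before_find 0 jk'; rewrite nth_iota ?add0n ?(ltn_trans jk) // => /negbT.
by [].
Qed.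

Lemma gdist_eq u v k : (k < #|T|)%N -> walk e k u v ->
  (forall j, (j < k)%N -> ~~ walk e j u v) -> gdist e u v = k.
Proof.
move=> kT wk min_k; rewrite /gdist.
set P := fun k => walk e k u v; set m := find P _.
have le_mk : (m <= k)%N.
  rewrite leqNgt; apply/negP=> km; have := before_find 0 km.
  by rewrite nth_iota // add0n /P wk.
apply/eqP; rewrite eqn_leq le_mk leqNgt; apply/negP=> mk.
have mT := ltn_trans mk kT.
have := nth_find 0 (a := P) (s := iota 0 #|T|).
rewrite has_find size_iota -/m => /(_ mT); rewrite nth_iota // add0n.
by apply/negP/min_k.
Qed.

Lemma leq_diameter u v : (gdist e u v <= diameter e)%N.
Proof.
apply: leq_trans (leq_bigmax_cond (F := fun u => \max_v gdist e u v) u _) => //.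
exact: (leq_bigmax_cond (F := fun v => gdist e u v) v).
Qed.

End Distance.
Lemma gautP (T : finType) (e : rel T) (s : {perm T}) :
  reflect (forall u v, e (s u) (s v) = e u v) (s \in gaut e).
Proof.
rewrite inE; apply: (iffP forallP) => [aut_s u v | aut_s u].
  exact/eqP/(forallP (aut_s u)).
by apply/forallP=> v; rewrite aut_s.
Qed.

Lemma actpermRE (gT : finGroupType) (g h : gT) : actperm 'R g h = h * g.
Proof. by rewrite actpermE. Qed.

Section CayleyGraph.
Variables (gT : finGroupType) (X Y : {group gT}).
Let Gamma := C_graph X Y.

Lemma C_graphE g h : Gamma g h = (g != h) && (h * g^-1 \in X :|: Y).
Proof. by rewrite /Gamma /C_graph /cayley in_setD1 mulg_eq1 invgK eq_sym. Qed.

Lemma C_graph_sym : symmetric Gamma.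
Proof.
move=> g h; rewrite !C_graphE eq_sym; congr (_ && _).
by rewrite -[g * h^-1]invgK invMg invgK !inE !groupV.
Qed.

Lemma C_graph_irr : irreflexive Gamma.
Proof. by move=> g; rewrite C_graphE eqxx. Qed.

Lemma C_graph_connect : <<X :|: Y>> = [set: gT] -> forall g h, connect Gamma g h.
Proof.
move=> genXY g h; rewrite -(mulgVK g h); move: (h * g^-1).
apply: (gen_ind genXY) => [|k l XYk IH]; first by rewrite mul1g connect0.
apply: connect_trans IH _; have [-> | k1] := eqVneq k 1; first by rewrite mul1g connect0.
apply: connect1; rewrite C_graphE -mulgA mulgK XYk andbT.
by rewrite -{1}[l * g]mul1g (inj_eq (@mulIg _ _)) eq_sym.
Qed.

Lemma C_graph_right g : actperm 'R g \in gaut Gamma.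
Proof.
apply/gautP=> h k; rewrite !actpermRE !C_graphE (inj_eq (@mulIg _ _)).
by rewrite invMg mulgA mulgK.
Qed.

Lemma C_graph_aut (alpha : gT -> gT) (inj_a : injective alpha) :
    {morph alpha : g h / g * h} ->
    {mono alpha : g / g \in X :|: Y} ->
  perm inj_a \in gaut Gamma.
Proof.
move=> aM aXY; apply/gautP=> g h; rewrite !permE !C_graphE (inj_eq inj_a).
suff -> : alpha h * (alpha g)^-1 = alpha (h * g^-1) by rewrite aXY.
by apply: (mulIg (alpha g)); rewrite mulgVK -aM mulgVK.
Qed.

Lemma C_graph_vertex_transitive : vertex_transitive Gamma.
Proof.
apply/imsetP; exists 1; rewrite ?inE //; apply/setP=> g; rewrite inE; apply/esym.
apply/imsetP; exists (actperm 'R g); first exact: C_graph_right.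
by rewrite /= /aperm actpermRE mul1g.
Qed.

Hypotheses (octXY : octagon_pair X Y) (octYX : octagon_pair Y X).
Hypothesis genXY : <<X :|: Y>> = [set: gT].
Hypothesis swapXY : exists2 sigma : gT -> gT,
  {morph sigma : g h / g * h} /\ involutive sigma &
  forall g, (sigma g \in X) = (g \in Y) /\ (sigma g \in Y) = (g \in X).
Hypothesis autXY : forall x x' y y',
  x \in X^# -> x' \in X^# -> y \in Y^# -> y' \in Y^# ->
  exists2 alpha : gT -> gT,
    [/\ {morph alpha : g h / g * h}, injective alpha,
        {mono alpha : g / g \in X} & {mono alpha : g / g \in Y}] &
    alpha x = x' /\ alpha y = y'.

Let XY1 g : g \in X -> g \in Y -> g = 1.
Proof.
case: octXY => TI _ _ _ _ Xg Yg; apply/eqP; rewrite -in_set1.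
by have : g \in X :&: Y; [rewrite inE Xg | rewrite TI].
Qed.

Let ex_x : exists x, x \in X^#.
Proof. by case: octYX => _ _ _ _ /(_ 1 (group1 X))[x]; exists x. Qed.

Let ex_y : exists y, y \in Y^#.
Proof. by case: octXY => _ _ _ _ /(_ 1 (group1 Y))[x]; exists x. Qed.

Let GammaD1 g h : Gamma g h = (h * g^-1 \in X^#) || (h * g^-1 \in Y^#).
Proof. by rewrite /Gamma /C_graph /cayley !inE; case: (_ == 1). Qed.

(** Once v is translated to 1, the ends lie in X or Y, but not both in the same one, since each is a
    clique. The swap puts the X-end first, and [autXY] moves the pair to (x0, y0). *)
Lemma C_geodesic_canonical x0 y0 u v w :
    x0 \in X^# -> y0 \in Y^# -> two_geodesic Gamma u v w ->
  exists2 s, s \in gaut Gamma & [/\ s u = x0, s v = 1 & s w = y0].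
Proof.
move=> X0 Y0 /andP[/and3P[neq_uw]]; rewrite C_graph_sym !(GammaD1 v).
set a := u * v^-1; set b := w * v^-1 => Sa Sb.
have -> : Gamma u w = Gamma a b.
  have /gautP <- := C_graph_right v^-1; rewrite !actpermRE //.
rewrite C_graphE => /nandP[|ba].
  by rewrite negbK (inj_eq (@mulIg _ _)) (negPf neq_uw).
have R := C_graph_right v^-1.
have sR k : actperm 'R v^-1 k = k * v^-1 by rewrite actpermRE.
have sub A : A = X \/ A = Y -> a \in A^# -> b \in A^# -> False.
  move=> dA /setD1P[_ Aa] /setD1P[_ Ab]; case/negP: ba.
  by apply/setUP; case: dA Aa Ab => -> Aa Ab; [left | right]; rewrite groupM ?groupV.
have canon a' b' (s : {perm gT}) : a' \in X^# -> b' \in Y^# -> s \in gaut Gamma ->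
    s u = a' -> s v = 1 -> s w = b' ->
    exists2 s, s \in gaut Gamma & [/\ s u = x0, s v = 1 & s w = y0].
  move=> Xa' Yb' As su sv sw.
  have [al [aM ainj aX aY] [ax ay]] := autXY Xa' X0 Yb' Y0.
  exists (s * perm ainj); last by rewrite !permM su sv sw !permE ax ay morph_mul1.
  rewrite groupM // C_graph_aut // => k; by rewrite !inE aX aY.
case/orP: Sa => Aa; case/orP: Sb => Ab.
- by case: (sub X); auto.
- by apply: (canon a b _ Aa Ab R); rewrite sR ?mulgV.
- have [sg [sM sI] sXY] := swapXY; have sinj := can_inj sI.
  have S1 g (A B : {group gT}) : (forall g, (sg g \in B) = (g \in A)) ->
      g \in A^# -> sg g \in B^#.
    move=> sAB /setD1P[g1 Ag]; rewrite !inE sAB Ag andbT.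
    by rewrite -(morph_mul1 sM) (inj_eq sinj).
  have sX g : (sg g \in X) = (g \in Y) by case: (sXY g).
  have sY g : (sg g \in Y) = (g \in X) by case: (sXY g).
  apply: (canon (sg a) (sg b) (actperm 'R v^-1 * perm sinj)).
  - exact: S1 Aa.
  - exact: S1 Ab.
  - by rewrite groupM // C_graph_aut // => k; rewrite !inE sX sY orbC.
  - by rewrite permM sR permE.
  - by rewrite permM sR permE mulgV morph_mul1.
  by rewrite permM sR permE.
by case: (sub Y); auto.
Qed.

Lemma C_two_geodesic_transitive : two_geodesic_transitive Gamma.
Proof.
split; first exact: C_graph_vertex_transitive.
move=> u v w u' v' w'; have [[x0 X0] [y0 Y0]] := (ex_x, ex_y).
case/(C_geodesic_canonical X0 Y0) => s As [su sv sw].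
case/(C_geodesic_canonical X0 Y0) => t At [tu tv tw].
exists (s * t^-1); first by rewrite groupM ?groupV.
by rewrite !permM su sv sw -tu -tv -tw !permK.
Qed.


Lemma C_graph_aut_XY (s : {perm gT}) : s \in gaut Gamma -> forall g h,
  (s g * (s h)^-1 \in X :|: Y) = (g * h^-1 \in X :|: Y).
Proof.
move=> /gautP As g h; have [-> | neq_hg] := eqVneq h g.
  by rewrite !mulgV !inE !group1.
by have := As h g; rewrite !C_graphE (inj_eq perm_inj) neq_hg.
Qed.

End CayleyGraph.

Section LabelTypes.
Variables (gT : finGroupType) (X Y : {group gT}).
Hypothesis TI : X :&: Y = 1.
Variable s : {perm gT}.
Hypothesis s_XY : forall g h,
  (s g * (s h)^-1 \in X :|: Y) = (g * h^-1 \in X :|: Y).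

Let XY1 g : g \in X -> g \in Y -> g = 1.
Proof.
move=> Xg Yg; apply/eqP; rewrite -in_set1.
by have : g \in X :&: Y; [rewrite inE Xg | rewrite TI].
Qed.

(** The neighbours of a vertex form two cliques with no edge between them, one from X and one from
    Y, so the image of a single neighbour decides where both cliques go. *)
Lemma label_type_spread h x0 : x0 \in X^# -> edge_label s h x0 \in X ->
  {in X, forall x, edge_label s h x \in X}
    /\ {in Y, forall y, edge_label s h y \in Y}.
Proof.
case/setD1P=> x01 Xx0 Xl0.
have label_div g k : edge_label s h g * (edge_label s h k)^-1
    = s (g * h) * (s (k * h))^-1.
  by rewrite /edge_label invMg invgK mulgA mulgVK.
have div_XY g k : (edge_label s h g * (edge_label s h k)^-1 \in X :|: Y)
    = (g * k^-1 \in X :|: Y).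
  by rewrite label_div s_XY invMg mulgA mulgK.
have l1 : edge_label s h 1 = 1 by rewrite /edge_label mul1g mulgV.
have label_XY g : (edge_label s h g \in X :|: Y) = (g \in X :|: Y).
  by have := div_XY g 1; rewrite l1 invg1 !mulg1.
have label_eq1 g : edge_label s h g = 1 -> g = 1.
  move=> lg; apply: (mulIg h); apply: (@perm_inj _ s); apply: (mulIg (s h)^-1).
  by rewrite mul1g mulgV.
split=> [x Xx | y Yy].
  have: edge_label s h x \in X :|: Y by rewrite label_XY inE Xx.
  case/setUP=> // Yl; have: x * x0^-1 \in X :|: Y by rewrite inE groupM ?groupV.
  rewrite -div_XY => /setUP[]; first by rewrite groupMr ?groupV.
  rewrite (groupMl _ Yl) groupV => /(XY1 Xl0)/label_eq1 x0E.
  by rewrite x0E eqxx in x01.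
have [-> | y1] := eqVneq y 1; first by rewrite l1 group1.
have: edge_label s h y \in X :|: Y by rewrite label_XY inE Yy orbT.
case/setUP=> // Xl.
have: y * x0^-1 \in X :|: Y by rewrite -div_XY inE groupM ?groupV.
case/setUP=> [yX|yY].
  have Xy : y \in X by rewrite -(mulgVK x0 y) groupM.
  by rewrite (XY1 Xy Yy) eqxx in y1.
have Yx0 : x0 \in Y by rewrite -groupV -(mulKg y x0^-1) groupM ?groupV.
by rewrite (XY1 Xx0 Yx0) eqxx in x01.
Qed.

End LabelTypes.

(** * Normality of the Cayley graph, and its distances *)

Section CayleyRigidity.
Variables (gT : finGroupType) (X Y : {group gT}).
Let Gamma := C_graph X Y.
Hypotheses (octXY : octagon_pair X Y) (octYX : octagon_pair Y X).
Hypothesis genXY : <<X :|: Y>> = [set: gT].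
Hypothesis swapXY : exists2 sigma : gT -> gT,
  {morph sigma : g h / g * h} /\ involutive sigma &
  forall g, (sigma g \in X) = (g \in Y) /\ (sigma g \in Y) = (g \in X).

Let GammaE g h : Gamma g h = (g != h) && (h * g^-1 \in X :|: Y).
Proof. exact: C_graphE. Qed.

Let TI : X :&: Y = 1. Proof. by case: octXY. Qed.

Lemma C_fix1_keeps_type s x0 : s \in gaut Gamma -> s 1 = 1 ->
  x0 \in X^# -> s x0 \in X -> keeps_label_type s X Y.
Proof.
move=> As s1 X0 sX0.
have sXY := C_graph_aut_XY As; have sYX g h :
    (s g * (s h)^-1 \in Y :|: X) = (g * h^-1 \in Y :|: X).
  by rewrite setUC sXY.
have TIC : Y :&: X = 1 by rewrite setIC.
pose Q h := {in X, forall x, edge_label s h x \in X}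
    /\ {in Y, forall y, edge_label s h y \in Y}.
apply: (gen_ind (Q := Q) genXY).
  apply: (label_type_spread TI sXY X0).
  by rewrite /edge_label mulg1 s1 invg1 mulg1.
move=> k h XYk [QX QY]; have [-> | k1] := eqVneq k 1; first by rewrite mul1g.
(* Seen from k h, the edge to h has the inverse label; it carries the type from one vertex to the
   next. *)
have back : edge_label s (k * h) k^-1 = (edge_label s h k)^-1.
  by rewrite /edge_label mulKg invMg invgK.
case/setUP: XYk => Ak.
  apply: (label_type_spread (x0 := k^-1) TI sXY).
    by rewrite !inE groupV Ak invg_eq1 k1.
  by rewrite back groupV QX.
have [] := @label_type_spread _ Y X TIC s sYX (k * h) k^-1 => [||//].
  by rewrite !inE groupV Ak invg_eq1 k1.
by rewrite back groupV QY.
Qed.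

Lemma C_fix1_multiplicative s :
  s \in gaut Gamma -> s 1 = 1 -> {morph s : g h / g * h}.
Proof.
move=> As s1; have [x0 X0] : exists x, x \in X^#.
  by case: octYX => _ _ _ _ /(_ 1 (group1 X))[x]; exists x.
have: s x0 \in X :|: Y.
  have := C_graph_aut_XY As x0 1; rewrite s1 invg1 !mulg1 => ->.
  by case/setD1P: X0 => _ X0; rewrite inE X0.
case/setUP=> sx0.
  have kl := C_fix1_keeps_type As s1 X0 sx0.
  exact: (label_type_multiplicative (@perm_inj _ s) octXY octYX kl genXY s1).
have [sg [sM sI] sXY] := swapXY; pose t := s * perm (can_inj sI).
have tE g : t g = sg (s g) by rewrite permM permE.
have At : t \in gaut Gamma.
  rewrite groupM // C_graph_aut // => g; rewrite !inE.
  by case: (sXY g) => -> ->; rewrite orbC.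
have sg1 := morph_mul1 sM.
have t1 : t 1 = 1 by rewrite tE s1.
have kl : keeps_label_type t X Y.
  by apply: (C_fix1_keeps_type At t1 X0); rewrite tE; case: (sXY (s x0)) => ->.
have tM := label_type_multiplicative (@perm_inj _ t) octXY octYX kl genXY t1.
by move=> g h; apply: (can_inj sI); rewrite sM -!tE tM.
Qed.

Lemma C_normal_cayley : normal_cayley (C_conn X Y).
Proof.
split=> [|g|]; first by rewrite !inE eqxx.
  by rewrite !inE !groupV invg_eq1.
apply/andP; split.
  apply/subsetP=> _ /morphimP[g _ _ ->]; exact: C_graph_right.
apply/subsetP=> s As; rewrite inE; apply/subsetP=> _ /imsetP[_ /morphimP[g _ _ ->] ->].
set r := actperm 'R (s 1)^-1; pose t := s * r.
have Ar : r \in gaut Gamma by apply: C_graph_right.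
have t1 : t 1 = 1 by rewrite permM actpermRE mulgV.
have tM : {morph t : g h / g * h}.
  by apply: C_fix1_multiplicative; rewrite // groupM.
(* Since s h = t h * s 1 with t multiplicative, s (h g) = t h * t g * s 1 = s h * (t g ^ s 1). *)
have -> : actperm 'R g ^ s = actperm 'R (t g ^ s 1).
  have sE h : s h = t h * s 1 by rewrite permM actpermRE mulgVK.
  apply/permP=> k; rewrite -(permKV s k); move: (s^-1 k) => h.
  by rewrite permJ !actpermRE (sE (h * g)) tM (sE h) -!mulgA mulKVg.
by rewrite mem_morphim ?inE.
Qed.

Hypothesis autXY : forall x x' y y',
  x \in X^# -> x' \in X^# -> y \in Y^# -> y' \in Y^# ->
  exists2 alpha : gT -> gT,
    [/\ {morph alpha : g h / g * h}, injective alpha,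
        {mono alpha : g / g \in X} & {mono alpha : g / g \in Y}] &
    alpha x = x' /\ alpha y = y'.
Hypothesis no_square : forall x1 x2 y1 y2,
  [/\ x1 \in X^#, x2 \in X^#, y1 \in Y^# & y2 \in Y^#] ->
  x1 * y1 * x2 * y2 <> 1.
(** Distances up to 3 have to stay below the junk value of [gdist]. *)
Hypothesis gT_gt3 : (3 < #|{: gT}|)%N.

Let ex_x x : x \in X -> exists2 x', x' \in X^# & x' != x.
Proof. by case: octYX => _ _ _ _; apply. Qed.

Let ex_y : exists y, y \in Y^#.
Proof. by case: octXY => _ _ _ _ /(_ 1 (group1 Y))[x]; exists x. Qed.

Let XY1 g : g \in X -> g \in Y -> g = 1.
Proof.
move=> Xg Yg; apply/eqP; rewrite -in_set1.
by have : g \in X :&: Y; [rewrite inE Xg | rewrite TI].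
Qed.

Let inX x : x \in X^# -> x \in X. Proof. by case/setD1P. Qed.
Let inY y : y \in Y^# -> y \in Y. Proof. by case/setD1P. Qed.

Let nontriv x y : x \in X^# -> y \in Y^# -> (x \in Y = false) * (y \in X = false).
Proof.
case/setD1P=> x1 Xx /setD1P[y1 Yy].
by split; [apply: contraNF x1 | apply: contraNF y1] => ?; apply/eqP/XY1.
Qed.

Let nadj x y : x \in X^# -> y \in Y^# -> ~~ Gamma x y.
Proof.
move=> X1 Y1; rewrite GammaE negb_and; apply/orP; right.
have [xY yX] := nontriv X1 Y1.
apply/negP; case/setUP=> [Xyx | Yyx].
  suff: y \in X by rewrite yX.
  by rewrite -(mulgVK x y) groupM ?(inX X1).
suff: x \in Y by rewrite xY.
by rewrite -groupV -(mulKg y x^-1) groupM ?groupV ?(inY Y1).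
Qed.

Let adj1 g : g != 1 -> g \in X :|: Y -> Gamma 1 g.
Proof. by move=> g1 XYg; rewrite GammaE eq_sym g1 invg1 mulg1. Qed.

Let Gamma_sym : symmetric Gamma. Proof. exact: C_graph_sym. Qed.

Let geod x y : x \in X^# -> y \in Y^# -> two_geodesic Gamma x 1 y.
Proof.
move=> X1 Y1; rewrite /two_geodesic nadj // andbT.
have [xY yX] := nontriv X1 Y1; case/setD1P: (X1) (Y1) => x1 Xx /setD1P[y1 Yy].
apply/and3P; split; first by apply: contraFneq yX => <-.
  by rewrite Gamma_sym adj1 // inE Xx.
by rewrite adj1 // inE Yy orbT.
Qed.

Lemma C_not_complete : ~ complete_graph Gamma.
Proof.
have [y Y1] := ex_y; have [x X1 _] := ex_x (group1 X).
have [_ yX] := nontriv X1 Y1.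
move/(_ x y); rewrite (negPf (nadj X1 Y1)) => /(_ _)/notF; apply.
by apply: contraFneq yX => <-; apply: inX.
Qed.

(** The 2-arc (x, 1, x') lies in the clique X, while the ends of (x, 1, y) are not adjacent. *)
Lemma C_not_two_arc_transitive : ~ two_arc_transitive Gamma.
Proof.
have [y Y1] := ex_y; have [x X1 _] := ex_x (group1 X).
have [x' X1' neq_xx] := ex_x (inX X1).
have /andP[arc _] := geod X1 Y1.
have Gxx' : Gamma x x'.
  by rewrite GammaE eq_sym neq_xx inE groupM ?groupV ?inX.
have arc' : two_arc Gamma x 1 x'.
  rewrite /two_arc eq_sym neq_xx /=; case/and3P: arc => _ -> _ /=.
  by case/setD1P: X1' => x'1 Xx'; rewrite adj1 // inE Xx'.
move=> /(_ _ _ _ _ _ _ arc arc')[s /gautP As [sx _ sy]].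
by move: (nadj X1 Y1); rewrite -As sx sy Gxx'.
Qed.

(** After merging neighbouring letters of one type, such an equality would give a trivial
    alternating word of length four, or put a nontrivial letter into both X and Y. As a and b may be
    1, distances 0, 1 and 2 are excluded at once. *)
Let word3 x y x' : x \in X^# -> y \in Y^# -> x' \in X^# ->
  forall a b, a \in X :|: Y -> b \in X :|: Y -> x * y * x' <> a * b.
Proof.
move=> X1 Y1 X1' a b XYa XYb e.
have [xY yX] := nontriv X1 Y1; have [x'Y _] := nontriv X1' Y1.
have [Xx Yy Xx'] := And3 (inX X1) (inY Y1) (inX X1').
have notX c : c \in X -> x * y * x' <> c.
  move=> Xc ec; move: yX; rewrite -(mulKg x y) -(mulgK x' (x * y)) ec.
  by rewrite !groupM ?groupV.
have notY c : c \in Y -> x * y * x' <> c.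
  move=> Yc ec; have [c1 | c1] := eqVneq c 1; first by case: (notX 1); rewrite // ec.
  apply: (@no_square x x' y c^-1); last by rewrite ec mulgV.
  by split; rewrite // !inE groupV invg_eq1 c1.
case/setUP: XYa XYb => Aa /setUP[] Bb.
- by apply: notX e; rewrite groupM.
- have e1 : a^-1 * x * y * x' * b^-1 = 1.
    by rewrite -!mulgA (mulgA x) (mulgA _ x') e mulgK mulVg.
  have [ax | ax] := eqVneq (a^-1 * x) 1.
    have e2 : y * x' * b^-1 = 1 by rewrite -[RHS]e1 ax mul1g.
    move: x'Y; rewrite -(mulKg y x') -(mulgVK b (y * x')) e2 mul1g.
    by rewrite groupM ?groupV.
  have [b1 | b1] := eqVneq b 1; first by case: (notX a); rewrite // e b1 mulg1.
  apply: (@no_square (a^-1 * x) x' y b^-1) => //.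
  by split; rewrite // !inE ?groupV ?invg_eq1 ?b1 // ax groupM ?groupV.
- have e1 : x * y * (x' * b^-1) * a^-1 = 1 by rewrite !mulgA e mulgK mulgV.
  have [xb | xb] := eqVneq (x' * b^-1) 1.
    have e2 : x * y * a^-1 = 1 by rewrite -[RHS]e1 xb mulg1.
    move: xY; rewrite -(mulgK y x) -(mulgVK a (x * y)) e2 mul1g.
    by rewrite groupM ?groupV.
  have [a1 | a1] := eqVneq a 1; first by case: (notX b); rewrite // e a1 mul1g.
  apply: (@no_square x (x' * b^-1) y a^-1) => //.
  by split; rewrite // !inE ?groupV ?invg_eq1 ?a1 // xb groupM ?groupV.
by apply: notY e; rewrite groupM.
Qed.

Lemma C_gdist3 x y x' : x \in X^# -> y \in Y^# -> x' \in X^# ->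
  gdist Gamma 1 (x * y * x') = 3.
Proof.
move=> X1 Y1 X1'; have w3 := word3 X1 Y1 X1'.
have XY1' : 1 \in X :|: Y by rewrite inE group1.
have GammaXY g h : Gamma g h -> h * g^-1 \in X :|: Y.
  by rewrite GammaE => /andP[].
have step a g : a != 1 -> a \in X :|: Y -> Gamma g (a * g).
  move=> a1 XYa; rewrite GammaE mulgK XYa andbT.
  by rewrite -{1}[g]mul1g (inj_eq (@mulIg _ _)) eq_sym.
apply: gdist_eq => //.
  rewrite !walkS; apply/existsP; exists x'; apply/andP; split.
    by case/setD1P: X1' => x'1 Xx'; rewrite adj1 // inE Xx'.
  rewrite walkS; apply/existsP; exists (y * x'); apply/andP; split.
    by case/setD1P: Y1 => y1 Yy; rewrite step // inE Yy orbT.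
  rewrite walk1 -mulgA.
  by case/setD1P: X1 => x1 Xx; rewrite step // inE Xx.
case=> [|[|[|//]]] _.
- by rewrite walk0; apply/eqP=> e; apply: (w3 1 1); rewrite // mulg1 -e.
- rewrite walk1; apply/negP=> /GammaXY; rewrite invg1 mulg1 => XYg.
  by apply: (w3 _ 1 XYg XY1'); rewrite mulg1.
rewrite walkS; apply/negP=> /existsP[w /andP[/GammaXY]]; rewrite invg1 mulg1.
move=> XYw; rewrite walk1 => /GammaXY XYg.
by apply: (w3 _ _ XYg XYw); rewrite mulgVK.
Qed.

Lemma C_diameter_ge3 : (3 <= diameter Gamma)%N.
Proof.
have [y Y1] := ex_y; have [x X1 _] := ex_x (group1 X).
by rewrite -(C_gdist3 X1 Y1 X1) leq_diameter.
Qed.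

Lemma C_not_distance_transitive : ~ distance_transitive Gamma.
Proof.
have [y Y1] := ex_y; have [x X1 _] := ex_x (group1 X).
have [x' X1' neq_xx] := ex_x (inX X1).
case=> _ _ /(_ 3 C_diameter_ge3 _ _ _ _ (C_gdist3 X1 Y1 X1) (C_gdist3 X1 Y1 X1')).
case=> s As [s1 sw]; have sM := C_fix1_multiplicative As s1.
have [_ invX _ _ _] := octXY; have [_ invY _ _ _] := octYX.
have sq : x * y * x * (x * y * x) = 1.
  by rewrite -!mulgA (mulgA x x) (invX _ (inX X1)) mul1g (mulgA y y)
    (invY _ (inY Y1)) mul1g invX ?inX.
(* Rotated, this reads (x' x) y (x' x) y = 1, an alternating word of length four, because x' x is
   not 1. *)
have /mulg_rot : x * y * x' * x * y * x' = 1.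
  by have := sM (x * y * x) (x * y * x); rewrite sq s1 sw !mulgA.
rewrite !mulgA => e; apply: (@no_square (x' * x) (x' * x) y y).
  have X1'' : x' * x \in X^#.
    rewrite !inE groupM ?inX // andbT; apply: contra neq_xx => /eqP e1.
    by apply/eqP; apply: (mulIg x); rewrite e1 invX ?inX.
  by split.
by rewrite -[RHS]e !mulgA.
Qed.

(** A pair at distance one extends to a 2-geodesic, and a pair at distance two consists of the ends
    of one. *)
Lemma C_two_distance_transitive : two_distance_transitive Gamma.
Proof.
have [tv tg] := C_two_geodesic_transitive octXY octYX swapXY autXY.
have [y Y1] := ex_y; have [x X1 _] := ex_x (group1 X).
split; [exact: C_not_complete | exact: ltnW C_diameter_ge3 |].
have dist i u v : (i <= 2)%N -> gdist Gamma u v = i ->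
    walk Gamma i u v /\ forall j, (j < i)%N -> ~~ walk Gamma j u v.
  by move=> i2; apply: gdistP; apply: leq_ltn_trans i2 (ltnW gT_gt3).
have arc2 u v : Gamma u v -> exists w, two_geodesic Gamma u v w.
  have GR g h k : Gamma (g * k) (h * k) = Gamma g h.
    by rewrite !GammaE (inj_eq (@mulIg _ _)) invMg mulgA mulgK.
  have shift a b : two_geodesic Gamma a 1 b -> two_geodesic Gamma (a * v) v (b * v).
    rewrite /two_geodesic /two_arc -{4 5}[v]mul1g !GR.
    by rewrite (inj_eq (@mulIg _ _)).
  rewrite Gamma_sym GammaE => /andP[neq_vu]; rewrite -(mulgVK v u) mulgK.
  have: u * v^-1 != 1 by rewrite mulg_eq1 invgK eq_sym.
  move: (u * v^-1) => a a1 /setUP[] Aa.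
    have A1 : a \in X^# by rewrite !inE a1.
    by exists (y * v); apply/shift/geod.
  have A1 : a \in Y^# by rewrite !inE a1.
  exists (x * v); apply/shift; move: (geod X1 A1).
  rewrite /two_geodesic /two_arc eq_sym (Gamma_sym x 1) (Gamma_sym 1 a) (Gamma_sym x a).
  by case/andP=> /and3P[-> -> ->] ->.
move=> i i2 u v u' v' /(dist _ _ _ i2)[w1 nw1] /(dist _ _ _ i2)[w2 nw2].
case: i i2 w1 w2 nw1 nw2 => [|[|[|//]]] _.
- rewrite !walk0 => /eqP <- /eqP <- _ _.
  have [s As su] := atransP2 tv (in_setT u) (in_setT u').
  by exists s.
- rewrite !walk1 => /arc2[w g1] /arc2[w' g2] _ _.
  by case: (tg _ _ _ _ _ _ g1 g2) => s As [su sv _]; exists s.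
have far a b : walk Gamma 2 a b -> (forall j, (j < 2)%N -> ~~ walk Gamma j a b) ->
    exists w, two_geodesic Gamma a w b.
  rewrite walkS => /existsP[w /andP[aw]]; rewrite walk1 => wb far_ab.
  have := far_ab 0 isT; have := far_ab 1%N isT; rewrite walk0 walk1 => nab ab.
  by exists w; rewrite /two_geodesic /two_arc ab aw wb nab.
move=> w1 w2 nw1 nw2; have [w g1] := far _ _ w1 nw1; have [w' g2] := far _ _ w2 nw2.
by case: (tg _ _ _ _ _ _ g1 g2) => s As [su _ sv]; exists s.
Qed.

Lemma C_simple_connected : simple_connected_graph Gamma.
Proof.
by split; [exact: C_graph_sym | exact: C_graph_irr | exact: C_graph_connect].
Qed.

End CayleyRigidity.
(** * The coset graph and its quotient *)

Section SigmaGraph.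
Variables (gT : finGroupType) (X Y : {group gT}).
Hypotheses (TI : X :&: Y = 1) (X_nontriv : exists x, x \in X^#).
Let V := Sigma_vertex X Y.
Let Sigma := Sigma_graph X Y.

Fact is_coset_X g : is_coset X Y (X :* g).
Proof. by rewrite /is_coset inE mem_rcosets mulSGid ?subsetT ?inE. Qed.

Fact is_coset_Y g : is_coset X Y (Y :* g).
Proof. by rewrite /is_coset inE !mem_rcosets mulSGid ?subsetT ?inE ?orbT. Qed.

Definition xcoset g : V := exist _ (X :* g) (is_coset_X g).
Definition ycoset g : V := exist _ (Y :* g) (is_coset_Y g).

Lemma Sigma_vertexP A : (exists g, A = xcoset g) \/ (exists g, A = ycoset g).
Proof.
case: A => A cA; case/setUP: (cA) => /rcosetsP[g _ eA].
  by left; exists g; apply: val_inj.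
by right; exists g; apply: val_inj.
Qed.

Lemma xcoset_eqE g h : (xcoset g == xcoset h) = (g * h^-1 \in X).
Proof.
rewrite -val_eqE /= -mem_rcoset; apply/eqP/idP=> [/rcoset_eqP //|].
by move/rcoset_eqP.
Qed.

Lemma ycoset_eqE g h : (ycoset g == ycoset h) = (g * h^-1 \in Y).
Proof.
rewrite -val_eqE /= -mem_rcoset; apply/eqP/idP=> [/rcoset_eqP //|].
by move/rcoset_eqP.
Qed.

Definition xside (A : V) : bool := val A \in rcosets X [set: gT].

Lemma xside_x g : xside (xcoset g).
Proof. by rewrite /xside mem_rcosets mulSGid ?subsetT ?inE. Qed.

(** If Y g were an X-coset it would be X g, and a nontrivial element of X would lie in Y. *)
Lemma xside_y g : xside (ycoset g) = false.
Proof.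
apply/negP=> /rcosetsP[h _ e]; have [x /setD1P[x1 Xx]] := X_nontriv.
have gX : g \in X :* h by rewrite -e rcoset_refl.
rewrite -(rcoset_eqP gX) /= in e.
have: x \in X :&: Y.
  by rewrite inE Xx -(mulgK g x) -mem_rcoset e mem_rcoset mulgK.
by rewrite TI inE (negPf x1).
Qed.

Definition xycoset (b : bool) := if b then xcoset else ycoset.

Lemma xside_xy b g : xside (xycoset b g) = b.
Proof. by case: b; rewrite ?xside_x ?xside_y. Qed.

Lemma xycosetP A : exists g, A = xycoset (xside A) g.
Proof.
by case: (Sigma_vertexP A) => -[g ->]; exists g; rewrite ?xside_x ?xside_y.
Qed.

Lemma yside_xy b g : (val (xycoset b g) \in rcosets Y [set: gT]) = ~~ b.
Proof.
case: b => /=; last by rewrite mem_rcosets mulSGid ?subsetT ?inE.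
apply/negP=> /rcosetsP[h _ e].
by move: (xside_y h); rewrite /xside /= -e mem_rcosets mulSGid ?subsetT ?inE.
Qed.

(** Cosets that meet in k are X k and Y k, so the edges are parametrized by the elements of the
    group. *)
Lemma Sigma_edgeP A B :
  reflect (exists b k, A = xycoset b k /\ B = xycoset (~~ b) k) (Sigma A B).
Proof.
apply: (iffP andP) => [[] | [c [k [-> ->]]]]; last first.
  rewrite !yside_xy -!/(xside _) !xside_xy; split; first by case: c.
  by apply/set0Pn; exists k; rewrite inE; case: c; rewrite /= !rcoset_refl.
have [g eA] := xycosetP A; have [h eB] := xycosetP B.
move: (xside A) (xside B) eA eB => a b -> ->.
rewrite !yside_xy -!/(xside _) !xside_xy => ab /set0Pn[k].
have -> : b = ~~ a by case: a b ab => [] [].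
by move=> /setIP[]; case: a {ab} => /= /rcoset_eqP ek1 /rcoset_eqP ek2;
  [exists true, k | exists false, k]; split; apply: val_inj.
Qed.

Lemma Sigma_sym : symmetric Sigma.
Proof.
move=> A B; apply/Sigma_edgeP/Sigma_edgeP=> -[b [k [-> ->]]];
  by exists (~~ b), k; rewrite negbK.
Qed.

Lemma Sigma_irr : irreflexive Sigma.
Proof.
move=> A; apply/Sigma_edgeP=> -[b [k [-> /(congr1 xside)]]].
by rewrite !xside_xy; case: b.
Qed.

Lemma Sigma_xy b k : Sigma (xycoset b k) (xycoset (~~ b) k).
Proof. by apply/Sigma_edgeP; exists b, k. Qed.

Lemma Sigma_connect : <<X :|: Y>> = [set: gT] ->
  forall A B, connect Sigma A B.
Proof.
move=> genXY.
have csym : connect_sym Sigma by apply: sym_connect_sym Sigma_sym.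
have cxy b k : connect Sigma (xycoset b k) (xcoset k).
  by case: b; [exact: connect0 | exact/connect1/(Sigma_xy false)].
suff to1 g : connect Sigma (xcoset g) (xcoset 1).
  move=> A B; have [g ->] := xycosetP A; have [h ->] := xycosetP B.
  apply: connect_trans (cxy _ _) (connect_trans (to1 g) _).
  by rewrite csym; apply: connect_trans (cxy _ _) (to1 h).
move: g; apply: (gen_ind genXY) => [|k g XYk IH]; first exact: connect0.
apply: connect_trans IH; case/setUP: XYk => Ak.
  suff /eqP-> : xcoset (k * g) == xcoset g by apply: connect0.
  by rewrite xcoset_eqE mulgK.
have e : ycoset (k * g) = ycoset g by apply/eqP; rewrite ycoset_eqE mulgK.
apply: connect_trans (cxy false g); rewrite /= -e csym.
exact: (cxy false).
Qed.

Lemma Sigma_simple_connected :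
  <<X :|: Y>> = [set: gT] -> simple_connected_graph Sigma.
Proof.
by move=> genXY; split; [exact: Sigma_sym | exact: Sigma_irr | exact: Sigma_connect].
Qed.

Lemma Sigma_gaut (s : {perm V}) (alpha beta : gT -> gT) c :
    cancel beta alpha ->
    (forall b k, s (xycoset b k) = xycoset (b (+) c) (alpha k)) ->
  s \in gaut Sigma.
Proof.
move=> bK sE; apply/gautP=> A B.
apply/Sigma_edgeP/Sigma_edgeP=> -[b [k [eA eB]]].
  exists (b (+) c), (beta k).
  by split; apply: (@perm_inj _ s); rewrite sE bK ?addNb addbK.
by exists (b (+) c), (alpha k); rewrite eA eB !sE addNb.
Qed.

Lemma Sigma_mul_xy b k g : Sigma_mul (xycoset b k) g = xycoset b (k * g).
Proof. by case: b; apply: val_inj; rewrite /= rcosetM. Qed.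

Definition Sigma_right : gT -> {perm V} := actperm (Sigma_action X Y).

Lemma Sigma_rightE g b k : Sigma_right g (xycoset b k) = xycoset b (k * g).
Proof. by rewrite /Sigma_right actpermE -Sigma_mul_xy. Qed.

Lemma Sigma_right_gaut g : Sigma_right g \in gaut Sigma.
Proof.
apply: (Sigma_gaut (alpha := mulg^~ g) (beta := mulg^~ g^-1) (c := false)).
  by move=> k; rewrite mulgVK.
by move=> b k; rewrite Sigma_rightE addbF.
Qed.

Lemma Sigma_aut (alpha : gT -> gT) (c : bool) :
    injective alpha -> {morph alpha : g h / g * h} ->
    (forall g, (alpha g \in X) = (g \in if c then Y else X)) ->
    (forall g, (alpha g \in Y) = (g \in if c then X else Y)) ->
  exists2 s, s \in gaut Sigma &
    forall b k, s (xycoset b k) = xycoset (b (+) c) (alpha k).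
Proof.
move=> ainj aM aX aY.
have key b r k : (xycoset (b (+) c) (alpha r) == xycoset (b (+) c) (alpha k))
    = (xycoset b r == xycoset b k).
  have aV : alpha r * (alpha k)^-1 = alpha (r * k^-1).
    by apply: (mulIg (alpha k)); rewrite mulgVK -aM mulgVK.
  by case: b; case: c aX aY => aX aY /=;
    rewrite ?xcoset_eqE ?ycoset_eqE aV ?aX ?aY.
(* By [key] the image does not depend on the representative that [repr] chooses. *)
pose f (A : V) : V := xycoset (xside A (+) c) (alpha (repr (val A))).
have fE b k : f (xycoset b k) = xycoset (b (+) c) (alpha k).
  rewrite /f xside_xy; apply/eqP; rewrite key.
  by case: b; rewrite /= ?xcoset_eqE ?ycoset_eqE -mem_rcoset mem_repr_rcoset.
have [beta bK aK] : bijective alpha by apply: injF_bij.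
have finj : injective f.
  move=> A B; have [g ->] := xycosetP A; have [h ->] := xycosetP B.
  move: (xside A) (xside B) => a b; rewrite !fE => e.
  have := congr1 xside e; rewrite !xside_xy => /addIb ab.
  by move/eqP: e; rewrite ab key => /eqP.
exists (perm finj); last by move=> b k; rewrite permE fE.
by apply: (Sigma_gaut aK (c := c)) => b k; rewrite permE fE.
Qed.

Hypothesis swapXY : exists2 sigma : gT -> gT,
  {morph sigma : g h / g * h} /\ involutive sigma &
  forall g, (sigma g \in X) = (g \in Y) /\ (sigma g \in Y) = (g \in X).
Hypothesis autXY : forall x x' y y',
  x \in X^# -> x' \in X^# -> y \in Y^# -> y' \in Y^# ->
  exists2 alpha : gT -> gT,
    [/\ {morph alpha : g h / g * h}, injective alpha,
        {mono alpha : g / g \in X} & {mono alpha : g / g \in Y}] &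
    alpha x = x' /\ alpha y = y'.

Lemma Sigma_swap : exists2 s, s \in gaut Sigma &
  exists2 sigma : gT -> gT, {morph sigma : g h / g * h} &
    forall b k, s (xycoset b k) = xycoset (~~ b) (sigma k).
Proof.
have [sg [sM sI] sXY] := swapXY.
have [||s As sE] := Sigma_aut (c := true) (can_inj sI) sM.
- by move=> g; case: (sXY g).
- by move=> g; case: (sXY g).
by exists s => //; exists sg => // b k; rewrite sE addbT.
Qed.

(** An arc with a Y-coset in the middle is (X k, Y k, X k') with k' k^-1 in Y^#. Right translation
    by k^-1 and an automorphism moving k' k^-1 to y0 normalize it; the swap reduces the other arcs
    to these. *)
Lemma Sigma_arc_canonical y0 u v w :
    y0 \in Y^# -> two_arc Sigma u v w ->
  exists2 s, s \in gaut Sigma &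
    [/\ s u = xcoset 1, s v = ycoset 1 & s w = xcoset y0].
Proof.
move=> Y0; wlog: u v w / xside v = false.
  move=> IH arc; case sv: (xside v); last exact: IH.
  have [s As [sg _ sE]] := Sigma_swap; have /gautP sA := As.
  have [||t At [tu tv tw]] := IH (s u) (s v) (s w).
  - by have [g ->] := xycosetP v; rewrite sv sE xside_xy.
  - by rewrite /two_arc (inj_eq perm_inj) !sA.
  by exists (s * t); [rewrite groupM | rewrite !permM].
move=> sv /and3P[neq_uw /Sigma_edgeP[b [k [eu ev]]] /Sigma_edgeP[b' [k' [ev' ew]]]].
have eb : b = true.
  by move: sv; rewrite ev xside_xy; case: (b).
have eb' : b' = false by move: sv; rewrite ev' xside_xy.
subst b b'.
have eY : k' * k^-1 \in Y by rewrite -ycoset_eqE -[ycoset k']ev' -[ycoset k]ev.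
have Y1 : k' * k^-1 \in Y^#.
  rewrite !inE eY andbT mulg_eq1 invgK; apply: contra neq_uw => /eqP ek.
  by rewrite eu ew ek.
have [x X1] := X_nontriv.
have [al [aM ainj aX aY] [_ ay]] := autXY X1 X1 Y1 Y0.
have a1 := morph_mul1 aM.
have [||s As sE] := Sigma_aut (c := false) ainj aM => //.
exists (Sigma_right k^-1 * s); first by rewrite groupM ?Sigma_right_gaut.
by rewrite !permM eu ev ew !Sigma_rightE !sE !addbF mulgV a1 ay.
Qed.

Lemma Sigma_two_arc_transitive : two_arc_transitive Sigma.
Proof.
have [y0 Y0] : exists y, y \in Y^#.
  have [x /setD1P[x1 Xx]] := X_nontriv; have [sg [sM sI] sXY] := swapXY.
  exists (sg x); rewrite !inE; case: (sXY x) => _ ->; rewrite Xx andbT.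
  have s1 := morph_mul1 sM.
  by rewrite -s1 (inj_eq (can_inj sI)).
move=> u v w u' v' w' /(Sigma_arc_canonical Y0)[s As [su sv sw]].
case/(Sigma_arc_canonical Y0) => t At [tu tv tw].
exists (s * t^-1); first by rewrite groupM ?groupV.
by rewrite !permM su sv sw -tu -tv -tw !permK.
Qed.

Lemma Sigma_valency : #|X| = #|Y| -> has_valency Sigma #|X|.
Proof.
move=> cXY A; have [g ->] := xycosetP A; move: (xside A) => b.
pose Z (c : bool) : {group gT} := if c then X else Y.
have ZE c k h : (xycoset c k == xycoset c h) = (k * h^-1 \in Z c).
  by case: c; rewrite /= ?xcoset_eqE ?ycoset_eqE.
have -> : #|X| = #|Z b| by case: (b).
have -> : [set v | Sigma (xycoset b g) v] = [set xycoset (~~ b) (z * g) | z in Z b].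
  apply/setP=> v; rewrite inE; apply/Sigma_edgeP/imsetP=> [[c [k [e ->]]] | [z Zz ->]].
    have := congr1 xside e; rewrite !xside_xy => cb; subst c.
    by exists (k * g^-1); [rewrite -ZE e | rewrite mulgVK].
  by exists b, (z * g); split=> //; apply/eqP; rewrite eq_sym ZE mulgK.
apply: card_in_imset => z1 z2 Z1 Z2 /eqP; rewrite ZE invMg mulgA mulgK => Z'.
have : z1 * z2^-1 \in X :&: Y.
  by rewrite inE; case: (b) Z1 Z2 Z' => /= Z1 Z2 ->; rewrite groupM ?groupV.
by rewrite TI => /set1P z12; apply: (mulIg z2^-1); rewrite mulgV.
Qed.

Lemma card_Sigma_vertex :
  #|Sigma_vertex X Y| = (#|[set: gT] : X| + #|[set: gT] : Y|)%N.
Proof.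
rewrite card_sig /=.
transitivity #|rcosets X [set: gT] :|: rcosets Y [set: gT]|.
  by apply: eq_card => A; rewrite !inE.
rewrite cardsU (_ : _ :&: _ = set0) ?cards0 ?subn0 //.
apply/setP=> A; rewrite !inE; apply/negP=> /andP[AX /rcosetsP[g _ eA]].
by move: (xside_y g); rewrite /xside /= -eA AX.
Qed.

End SigmaGraph.

(** * The quotient of the coset graph by the N-orbits *)

Lemma complete_bipartite_valency m : has_valency (@complete_bipartite m) m.
Proof.
case=> i; rewrite -[RHS]card_ord.
  have -> : [set v | complete_bipartite (inl i) v] = [set @inr 'I_m 'I_m j | j : 'I_m].
    apply/setP=> -[j | j]; rewrite inE /=; apply/esym; last exact: imset_f.
    by apply/negP=> /imsetP[].
  by rewrite card_imset //; apply: inr_inj.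
have -> : [set v | complete_bipartite (inr i) v] = [set @inl 'I_m 'I_m j | j : 'I_m].
  apply/setP=> -[j | j]; rewrite inE /=; apply/esym; first exact: imset_f.
  by apply/negP=> /imsetP[].
by rewrite card_imset //; apply: inl_inj.
Qed.

Section SigmaQuotient.
Variables (gT : finGroupType) (X Y N : {group gT}).
Hypotheses (TI : X :&: Y = 1) (X_nontriv : exists x, x \in X^#).
Hypotheses (centN : N \subset 'Z([set: gT])) (derN : [set: gT]^`(1) = N).
Hypothesis swapXY : exists2 sigma : gT -> gT,
  {morph sigma : g h / g * h} /\ involutive sigma &
  forall g, (sigma g \in X) = (g \in Y) /\ (sigma g \in Y) = (g \in X).

(** [c b] is the homomorphism onto F_2^n with kernel [side b * N], so it is constant on the cosets
    of [side b] and on their N-orbits. [mkc] finds an element with both values prescribed. *)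
Variables (n : nat) (c : bool -> gT -> 'rV['F_2]_n)
  (mkc : 'rV['F_2]_n -> 'rV['F_2]_n -> gT).
Let side (b : bool) : {group gT} := if b then X else Y.
Hypotheses (cM : forall b g h, c b (g * h) = (c b g + c b h)%R)
  (c_mkt : forall u v, c true (mkc u v) = u)
  (c_mkf : forall u v, c false (mkc u v) = v)
  (c0P : forall b g, (c b g == 0%R) = (g \in side b * N))
  (memN : forall g, (g \in N) = (c true g == 0%R) && (c false g == 0%R)).

Let V := Sigma_vertex X Y.
Let Sigma := Sigma_graph X Y.
Let NS := Sigma_perms X Y N.
Let xyc := @xycoset gT X Y.
Let xside_xyc b k : xside (xyc b k) = b := xside_xy TI X_nontriv b k.

Let c1 b : c b 1 = 0%R.
Proof. by apply: (addrI (c b 1)); rewrite -cM mulg1 addr0. Qed.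

Let cV b g : c b g^-1 = c b g.
Proof.
by apply: (addrI (c b g)); rewrite -cM mulgV c1 F2_addvv.
Qed.

Let c_N b z : z \in N -> c b z = 0%R.
Proof. by rewrite memN => /andP[/eqP ct /eqP cf]; case: b. Qed.

Let mk b d := if b then mkc d 0%R else mkc 0%R d.
Let c_mk b d : c b (mk b d) = d.
Proof. by case: b; rewrite /= ?c_mkt ?c_mkf. Qed.

Let ex_mk b u v : exists k, c b k = u /\ c (~~ b) k = v.
Proof.
by case: b; [exists (mkc u v) | exists (mkc v u)]; rewrite /= c_mkt c_mkf.
Qed.

Let xyc_eqE b g h : (xyc b g == xyc b h) = (g * h^-1 \in side b).
Proof. by case: b; rewrite /xyc /= ?xcoset_eqE ?ycoset_eqE. Qed.

Let c_side b g : g \in side b -> c b g = 0%R.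
Proof. by move=> Ag; apply/eqP; rewrite c0P (subsetP (mulG_subl N _)). Qed.

Definition coset_label (A : V) : bool * 'rV['F_2]_n :=
  (xside A, c (xside A) (repr (val A))).

Lemma coset_label_xy b k : coset_label (xyc b k) = (b, c b k).
Proof.
rewrite /coset_label xside_xyc; congr (_, _).
have r_in : repr (val (xyc b k)) * k^-1 \in side b.
  by rewrite /xyc /side; case: b; rewrite /= -mem_rcoset mem_repr_rcoset.
by have := c_side r_in; rewrite cM cV => /eqP; rewrite addr_eq0 F2_oppv => /eqP.
Qed.

Let NcentE z g : z \in N -> z * g = g * z.
Proof. by move/(subsetP centN)/centerP=> [_ ->] //; rewrite inE. Qed.

Lemma orbit_labelE A B : (B \in orbit 'P NS A) = (coset_label B == coset_label A).
Proof.
have [g ->] := xycosetP TI X_nontriv A; have [h ->] := xycosetP TI X_nontriv B.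
rewrite -/xyc; move: (xside A) (xside B) => a b.
rewrite !coset_label_xy; apply/orbitP/eqP=> [[_ /morphimP[z _ Nz ->]] | [-> e]].
  rewrite /= /aperm -/(Sigma_right X Y) Sigma_rightE -/xyc => e.
  have := congr1 coset_label e; rewrite !coset_label_xy => -[<- <-].
  by rewrite cM (c_N _ Nz) addr0.
have : h * g^-1 \in side a * N by rewrite -c0P cM cV e F2_addvv.
case/mulsgP=> x z Ax Nz hg; exists (Sigma_right X Y z).
  by rewrite mem_morphim ?inE.
have -> : h = x * (g * z) by rewrite -(NcentE g Nz) mulgA -hg mulgVK.
rewrite /= /aperm Sigma_rightE -/xyc; apply/eqP.
by rewrite eq_sym xyc_eqE mulgK.
Qed.

Fact orbit_in (A : V) : orbit 'P NS A \in orbit 'P NS @: [set: V].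
Proof. by apply: imset_f; rewrite inE. Qed.

Definition orbit_of (A : V) : orbit_type NS := exist _ (orbit 'P NS A) (orbit_in A).

Lemma orbit_ofP (B : orbit_type NS) : exists A, B = orbit_of A.
Proof.
by case: B => B PB; case/imsetP: (PB) => A _ eB; exists A; apply: val_inj.
Qed.

Lemma orbit_of_eqE A B : (orbit_of A == orbit_of B) = (coset_label A == coset_label B).
Proof.
rewrite -val_eqE /= -orbit_labelE; apply/eqP/idP=> [<-|]; first exact: orbit_refl.
by move/orbit_eqP.
Qed.

(** The default vertex is never reached, orbits being nonempty. *)
Definition orbit_label (B : orbit_type NS) : bool * 'rV['F_2]_n :=
  coset_label (odflt (xyc true 1) [pick A in val B]).

Lemma orbit_label_of A : orbit_label (orbit_of A) = coset_label A.
Proof.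
rewrite /orbit_label; case: pickP => [B /= | /(_ A)]; last by rewrite /= orbit_refl.
by rewrite orbit_labelE => /eqP.
Qed.

Lemma orbit_label_inj : injective orbit_label.
Proof.
move=> B C; have [A ->] := orbit_ofP B; have [A' ->] := orbit_ofP C.
by rewrite !orbit_label_of => e; apply/eqP; rewrite orbit_of_eqE e.
Qed.

Definition orbit_at (p : bool * 'rV['F_2]_n) := orbit_of (xyc p.1 (mk p.1 p.2)).

Lemma orbit_atK : cancel orbit_at orbit_label.
Proof. by case=> b d; rewrite orbit_label_of coset_label_xy c_mk. Qed.

Lemma orbit_labelK : cancel orbit_label orbit_at.
Proof. by move=> B; apply: orbit_label_inj; rewrite orbit_atK. Qed.

Lemma quotient_adjE B C :
  quotient_graph NS Sigma B C = ((orbit_label B).1 != (orbit_label C).1).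
Proof.
have [A ->] := orbit_ofP B; have [A' ->] := orbit_ofP C.
rewrite !orbit_label_of /quotient_graph orbit_of_eqE.
apply/andP/idP=> [[_ /existsP[u /andP[Au /existsP[v /andP[Av]]]]] | neq_side].
  rewrite /= orbit_labelE in Au; rewrite /= orbit_labelE in Av.
  rewrite -(eqP Au) -(eqP Av).
  case/(Sigma_edgeP TI X_nontriv)=> b [k [-> ->]]; rewrite -/xyc !coset_label_xy.
  by case: b.
split; first by apply: contraNneq neq_side => ->.
have [g eA] := xycosetP TI X_nontriv A; have [h eA'] := xycosetP TI X_nontriv A'.
move: eA eA' neq_side; rewrite -/xyc; move: (xside A) (xside A') => a b -> ->.
rewrite !coset_label_xy /= => ab; have -> : b = ~~ a by case: a b ab => [] [].
(* The values on the two sides can be prescribed independently; the edge of such a k joins the two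
   orbits. *)
have [k [ek ek']] := ex_mk a (c a g) (c (~~ a) h).
apply/existsP; exists (xyc a k); rewrite orbit_labelE !coset_label_xy ek eqxx /=.
apply/existsP; exists (xyc (~~ a) k); rewrite orbit_labelE !coset_label_xy ek' eqxx.
exact: Sigma_xy.
Qed.

Lemma quotient_complete_bipartite :
  graph_iso (quotient_graph NS Sigma) (@complete_bipartite (2 ^ n)).
Proof.
have cardD : #|{: 'rV['F_2]_n}| = (2 ^ n)%N.
  by rewrite -cardsT card_rowF2 mul1n.
pose e (d : 'rV['F_2]_n) : 'I_(2 ^ n) := cast_ord cardD (enum_rank d).
pose e' (i : 'I_(2 ^ n)) : 'rV['F_2]_n := enum_val (cast_ord (esym cardD) i).
have eK : cancel e e' by move=> d; rewrite /e' cast_ordK enum_rankK.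
have e'K : cancel e' e by move=> i; rewrite /e enum_valK cast_ordKV.
pose f (p : bool * 'rV['F_2]_n) : 'I_(2 ^ n) + 'I_(2 ^ n) :=
  if p.1 then inl (e p.2) else inr (e p.2).
pose f' (i : 'I_(2 ^ n) + 'I_(2 ^ n)) : bool * 'rV['F_2]_n :=
  match i with inl j => (true, e' j) | inr j => (false, e' j) end.
exists (f \o orbit_label).
  exists (orbit_at \o f') => [B | i] /=.
    by rewrite -[RHS]orbit_labelK; congr orbit_at; case: (orbit_label B) => -[] d /=;
      rewrite eK.
  by rewrite orbit_atK; case: i => j; rewrite /f /= e'K.
move=> B C; rewrite quotient_adjE [in LHS]/=.
by move: (orbit_label B) (orbit_label C) => [[] d] [[] d'].
Qed.

Lemma Sigma_perms_gaut (K : {group gT}) : Sigma_perms X Y K \subset gaut Sigma.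
Proof.
apply/subsetP=> _ /morphimP[g _ _ ->]; exact: (Sigma_right_gaut TI X_nontriv).
Qed.

Lemma Sigma_normal_cover : #|X| = (2 ^ n)%N -> #|Y| = (2 ^ n)%N ->
  normal_cover NS Sigma (@complete_bipartite (2 ^ n)).
Proof.
move=> cX cY; split; [|exact: quotient_complete_bipartite|]; last first.
  exists (2 ^ n)%N; split; last exact: complete_bipartite_valency.
  by rewrite -cX; apply: Sigma_valency; rewrite // cX.
(* The normalizer of N in the automorphism group contains the right translations and the swap, which
   suffices for vertex-transitivity. *)
pose G := ('N(NS) :&: gaut_group Sigma)%G; exists G.
split; first exact: subsetIr.
  apply/andP; split; last exact: subsetIl.
  by rewrite subsetI normG Sigma_perms_gaut.
have R_in g : Sigma_right X Y g \in G.
  rewrite inE (Sigma_right_gaut TI X_nontriv) // andbT inE.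
  apply/subsetP=> _ /imsetP[_ /morphimP[z _ Nz ->] ->].
  rewrite -morphJ ?inE // mem_morphim ?inE // conjgE (NcentE g Nz).
  by rewrite mulKg.
have [s As [sg sgM sE]] := Sigma_swap TI X_nontriv swapXY.
(* N is the derived subgroup, which every endomorphism maps into itself. *)
have sgN z : z \in N -> sg z \in N.
  rewrite -derN => Dz.
  pose P := Group (group_set_preim [set: gT]^`(1) sgM).
  suff /subsetP/(_ z Dz): [set: gT]^`(1) \subset P by rewrite inE.
  rewrite gen_subG; apply/subsetP=> _ /imset2P[g h _ _ ->]; rewrite inE.
  by rewrite (morph_commg sgM) mem_commg ?inE.
have s_in : s \in G.
  rewrite inE As andbT inE; apply/subsetP=> _ /imsetP[_ /morphimP[z _ Nz ->] ->].
  suff -> : actperm (Sigma_action X Y) z ^ s = Sigma_right X Y (sg z).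
    by rewrite mem_morphim ?inE // sgN.
  apply/permP=> A; rewrite -(permKV s A); move: (s^-1 A) => {}A.
  have [g ->] := xycosetP TI X_nontriv A.
  rewrite permJ -/(Sigma_right X Y z) Sigma_rightE !sE Sigma_rightE sgM //.
apply/imsetP; exists (xycoset X Y true 1); rewrite ?inE //; apply/setP=> A; rewrite inE.
apply/esym/orbitP; have [g ->] := xycosetP TI X_nontriv A.
case: (xside A).
  exists (Sigma_right X Y g); first exact: R_in.
  by rewrite -[LHS]/(Sigma_right X Y g (xycoset X Y true 1)) Sigma_rightE mul1g.
exists (s * Sigma_right X Y g); first by rewrite groupM ?R_in.
have sg1 := morph_mul1 sgM.
by rewrite -[LHS]/((s * Sigma_right X Y g) (xycoset X Y true 1)) permM sE sg1
  Sigma_rightE mul1g.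
Qed.


Lemma orbit_of_mul A g :
  [set Sigma_mul A' g | A' in val (orbit_of A)] = val (orbit_of (Sigma_mul A g)).
Proof.
apply/setP=> B; apply/imsetP/idP=> /= [[A' AA' ->] | ].
  move: AA'; rewrite !orbit_labelE.
  have [k ->] := xycosetP TI X_nontriv A; have [l ->] := xycosetP TI X_nontriv A'.
  rewrite !Sigma_mul_xy -/xyc !coset_label_xy !cM => /eqP[-> ->].
  exact: eqxx.
rewrite orbit_labelE; have [k ->] := xycosetP TI X_nontriv A.
have [l ->] := xycosetP TI X_nontriv B; move: (xside A) (xside B) => a b.
rewrite Sigma_mul_xy -/xyc !coset_label_xy cM => /eqP[-> e].
exists (xyc a (l * g^-1)); last by rewrite Sigma_mul_xy mulgVK.
rewrite orbit_labelE !coset_label_xy cM cV e -addrA F2_addvv addr0.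
exact: eqxx.
Qed.

(** The action of g read through the labels, a translation on each side; [val_orbit_mul] identifies
    it with the action on sets of cosets. *)
Definition orbit_mul g (B : orbit_type NS) : orbit_type NS :=
  orbit_at ((orbit_label B).1, ((orbit_label B).2 + c (orbit_label B).1 g)%R).

Lemma orbit_mul_label g B : orbit_label (orbit_mul g B) =
  ((orbit_label B).1, ((orbit_label B).2 + c (orbit_label B).1 g)%R).
Proof. exact: orbit_atK. Qed.

Lemma orbit_mulM g h B : orbit_mul (g * h) B = orbit_mul h (orbit_mul g B).
Proof.
by apply: orbit_label_inj; rewrite !orbit_mul_label /= cM addrA.
Qed.

Lemma orbit_mul_inj g : injective (orbit_mul g).
Proof.
apply: (can_inj (g := orbit_mul g^-1)) => B; apply: orbit_label_inj.
rewrite !orbit_mul_label; case: (orbit_label B) => b d /=.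
by rewrite cV -addrA F2_addvv addr0.
Qed.

Lemma val_orbit_mul g B :
  val (orbit_mul g B) = [set Sigma_mul A g | A in val B].
Proof.
have [A ->] := orbit_ofP B; rewrite orbit_of_mul; congr val.
apply: orbit_label_inj; rewrite orbit_mul_label !orbit_label_of.
have [k ->] := xycosetP TI X_nontriv A.
by rewrite Sigma_mul_xy -/xyc !coset_label_xy cM.
Qed.

Lemma orbit_mul_eq1 g : (g \in N) = [forall B, orbit_mul g B == B].
Proof.
rewrite memN; apply/andP/forallP=> [[/eqP ct /eqP cf] B | fixB].
  apply/eqP/orbit_label_inj; rewrite orbit_mul_label.
  by case: (orbit_label B) => -[] d /=; rewrite ?ct ?cf addr0.
have fixb b : c b g == 0%R.
  have /eqP/(congr1 orbit_label) := fixB (orbit_at (b, 0%R)).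
  by rewrite orbit_mul_label orbit_atK /= add0r => -[->].
by split.
Qed.

(** This makes the action on the orbits a faithful action of the quotient by N, the group of the
    edge-affine claim. *)
Lemma orbit_kernel g : (g \in N) =
  [forall B : orbit_type NS, [set Sigma_mul A g | A in val B] == val B].
Proof.
by rewrite orbit_mul_eq1; apply: eq_forallb => B; rewrite -val_orbit_mul val_eqE.
Qed.

Definition orbit_perm g : {perm orbit_type NS} := perm (@orbit_mul_inj g).

Lemma orbit_permM : {in [set: gT] &, {morph orbit_perm : g h / g * h}}.
Proof.
by move=> g h _ _; apply/permP=> B; rewrite permM !permE orbit_mulM.
Qed.
Canonical orbit_perm_morphism := Morphism orbit_permM.

Let L := induced_on_orbits_group NS (Sigma_perms X Y [set: gT]%G).

Lemma ker_orbit_perm : 'ker orbit_perm = N.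
Proof.
apply/setP=> g; rewrite !inE orbit_mul_eq1 /=; apply/eqP/forallP=> [e B | fixB].
  by have /permP/(_ B) := e; rewrite permE perm1 => ->.
by apply/permP=> B; rewrite permE perm1; apply/eqP.
Qed.

Lemma induced_orbit_perm : L = (orbit_perm @* [set: gT])%G.
Proof.
apply/val_inj/setP=> s /=; rewrite inE; apply/existsP/morphimP.
  case=> _ /andP[/morphimP[g _ _ ->] /forallP e]; exists g; rewrite ?inE //.
  apply/permP=> B; apply: val_inj; rewrite permE val_orbit_mul (eqP (e B)).
  by apply: eq_imset => A; rewrite /= actpermE.
case=> g _ _ ->; exists (Sigma_right X Y g); rewrite mem_morphim ?inE //=.
apply/forallP=> B; rewrite permE val_orbit_mul; apply/eqP.
by apply: eq_imset => A; rewrite /= actpermE.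
Qed.

Let label_morph (g : gT) : 'rV['F_2]_n * 'rV['F_2]_n := (c true g, c false g).

Let label_morphM : {in [set: gT] &, {morph label_morph : g h / g * h}}.
Proof. by move=> g h _ _; rewrite /label_morph !cM. Qed.

(** The action on the orbits and the pair of labels are homomorphisms with the same kernel N, hence
    with isomorphic images. *)
Lemma induced_isog : L \isog C2_pow_square n.
Proof.
pose f := Morphism label_morphM.
have kerf : 'ker f = N.
  by apply/setP=> g; rewrite !inE memN /= /label_morph.
have imf : f @* [set: gT] = C2_pow_square n.
  apply/setP=> -[u v]; rewrite inE; apply/morphimP; exists (mkc u v); rewrite ?inE //.
  by rewrite /= /label_morph c_mkt c_mkf.
have isoL := first_isog [morphism of orbit_perm].
have isof := first_isog f.
rewrite induced_orbit_perm /= -imf.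
apply: isog_trans isof; rewrite isog_sym.
by rewrite kerf -ker_orbit_perm.
Qed.

Let quotient := quotient_graph NS Sigma.

Lemma quotient_edgeP E : reflect
  (exists u v, E = [set orbit_at (true, u); orbit_at (false, v)])
  (E \in edges quotient).
Proof.
apply: (iffP imsetP) => [[[B C]] | [u [v ->]]]; last first.
  exists (orbit_at (true, u), orbit_at (false, v)) => //.
  by rewrite inE /= /quotient quotient_adjE !orbit_atK.
rewrite inE /= /quotient quotient_adjE => neq_side ->.
rewrite -[B]orbit_labelK -[C]orbit_labelK.
case: (orbit_label B) (orbit_label C) neq_side => -[] u [[] v] //= _.
  by exists u, v.
by exists v, u; rewrite setUC.
Qed.

Lemma orbit_perm_at g b d : orbit_perm g (orbit_at (b, d)) = orbit_at (b, (d + c b g)%R).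
Proof. by apply: orbit_label_inj; rewrite permE orbit_mul_label !orbit_atK. Qed.

Lemma induced_edge_affine : edge_affine n quotient L.
Proof.
split; first exact: quotient_complete_bipartite.
  rewrite induced_orbit_perm; apply/subsetP=> _ /morphimP[g _ _ ->].
  apply/gautP=> B C; rewrite /quotient !quotient_adjE !permE !orbit_mul_label.
  by [].
(* The whole induced group is the required normal subgroup. On the edge from (true, u) to (false, v)
   it acts as translation of the pair (u, v), which is regular. *)
exists L; split.
- exact: normal_refl.
- exact: induced_isog.
- apply/negP=> trL.
  have [s] := atransP2 trL (in_setT (orbit_at (true, 0%R)))
    (in_setT (orbit_at (false, 0%R))).
  rewrite induced_orbit_perm => /morphimP[g _ _ ->].
  by rewrite /= /aperm orbit_perm_at => /(congr1 orbit_label); rewrite !orbit_atK.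
- have E0 := introT (quotient_edgeP _) (ex_intro _ 0%R (ex_intro _ 0%R erefl)).
  apply/imsetP; exists [set orbit_at (true, 0%R); orbit_at (false, 0%R)] => //.
  apply/setP=> E; apply/quotient_edgeP/orbitP=> [[u [v ->]] | [s]].
    exists (orbit_perm (mkc u v)).
      by rewrite induced_orbit_perm mem_morphim ?inE.
    rewrite /= setactE imsetU1 imset_set1 /= /aperm !orbit_perm_at c_mkt c_mkf.
    by rewrite !add0r.
  rewrite induced_orbit_perm => /morphimP[g _ _ ->] <-.
  exists (c true g), (c false g).
  by rewrite /= setactE imsetU1 imset_set1 /= /aperm !orbit_perm_at !add0r.
move=> E /quotient_edgeP[u [v ->]]; apply/trivgP/subsetP=> s /setIP[].
rewrite induced_orbit_perm => /morphimP[g _ _ ->] /astab1P.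
rewrite /= setactE imsetU1 imset_set1 /= /aperm !orbit_perm_at => e.
have cancel0 (d d' : 'rV['F_2]_n) : (d + d')%R = d -> d' = 0%R.
  by move=> dd; apply: (addrI d); rewrite addr0.
have ct : c true g = 0%R.
  have : orbit_at (true, (u + c true g)%R)
      \in [set orbit_at (true, u); orbit_at (false, v)].
    by rewrite -e !inE eqxx.
  by rewrite !inE => /orP[] /eqP/(congr1 orbit_label);
    rewrite !orbit_atK // => -[/cancel0].
have cf : c false g = 0%R.
  have : orbit_at (false, (v + c false g)%R)
      \in [set orbit_at (true, u); orbit_at (false, v)].
    by rewrite -e !inE eqxx orbT.
  by rewrite !inE => /orP[] /eqP/(congr1 orbit_label);
    rewrite !orbit_atK // => -[/cancel0].
have : g \in 'ker orbit_perm by rewrite ker_orbit_perm memN ct cf !eqxx.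
by move/mker => /= ->; rewrite inE.
Qed.

End SigmaQuotient.

(** * Remaining facts in coordinates, and the theorem *)

Lemma C2_pow_abelem m : 2.-abelem (C2_pow m).
Proof.
apply/abelemP => //; split; first exact: FinRing.zmod_abelian.
by move=> u _; rewrite expg2; apply: F2_addvv.
Qed.

Lemma abelem_isog_C2_pow (gT : finGroupType) (A : {group gT}) m :
  2.-abelem A -> #|A| = (2 ^ m)%N -> A \isog C2_pow m.
Proof.
move=> abA cA; rewrite (isog_abelem_card _ abA) C2_pow_abelem cA.
by rewrite card_rowF2 mul1n eqxx.
Qed.

Section CoordinateProducts.
Variables (n : nat) (gT : finGroupType) (f : gT -> heis n) (mk : heis n -> gT).
Hypotheses (fK : cancel f mk) (fM : {morph f : g h / g * h}).
Variables X Y N : {group gT}.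
Hypotheses
  (memX : forall g, (g \in X) = ((f g).1.2 == 0%R) && ((f g).2 == 0%R))
  (memY : forall g, (g \in Y) = ((f g).1.1 == 0%R) && ((f g).2 == 0%R))
  (memN : forall g, (g \in N) = ((f g).1.1 == 0%R) && ((f g).1.2 == 0%R)).

Let f1 : f 1 = 1 := morph_mul1 fM.

(** The matrix component of the product is v^T u, with u from x2 and v from y1, and both rows are
    nonzero. *)
Lemma coord_no_square x1 x2 y1 y2 :
    [/\ x1 \in X^#, x2 \in X^#, y1 \in Y^# & y2 \in Y^#] ->
  x1 * y1 * x2 * y2 <> 1.
Proof.
case=> /setD1P[_ /(coordX memX) e1] /setD1P[x21 /(coordX memX) e2].
move=> /setD1P[y11 /(coordY memY) k1] /setD1P[_ /(coordY memY) k2].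
have u2 : (f x2).1.1 != 0%R.
  by apply: contra x21 => /eqP u0; rewrite -(inj_eq (can_inj fK)) f1 e2 u0.
have v1 : (f y1).1.2 != 0%R.
  by apply: contra y11 => /eqP u0; rewrite -(inj_eq (can_inj fK)) f1 k1 u0.
move=> /(congr1 (fun g => (f g).2)); rewrite f1 !fM e1 e2 k1 k2.
case/rV0Pn: u2 => i ui; case/rV0Pn: v1 => j vj.
rewrite !heis_mulE /= !(trmx0, mul0mx, mulmx0, addr0, add0r).
move/matrixP/(_ j i)/eqP; rewrite !mxE big_ord1 !mxE mulf_eq0.
by rewrite (negPf ui) (negPf vj).
Qed.

Lemma coord_sqr_N g : g * g \in N.
Proof. by rewrite memN fM /= !F2_addvv !eqxx. Qed.

Hypothesis mkK : cancel mk f.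

Lemma coord_X_N g : ((f g).1.2 == 0%R) = (g \in X * N).
Proof.
apply/eqP/mulsgP=> [v0 | [x z /(coordX memX) fx /(coordN memN) fz ->]]; last first.
  by rewrite fM fx fz /= addr0.
exists (mk ((f g).1.1, 0%R, 0%R)) (mk (0%R, 0%R, (f g).2)).
- exact: (mkX mkK memX).
- exact: (mkN mkK memN).
apply: (can_inj fK); rewrite fM !mkK heis_mulE trmx0 mul0mx !(addr0, add0r) -v0.
by case: (f g) => [[]].
Qed.

Lemma coord_Y_N g : ((f g).1.1 == 0%R) = (g \in Y * N).
Proof.
apply/eqP/mulsgP=> [u0 | [y z /(coordY memY) fy /(coordN memN) fz ->]]; last first.
  by rewrite fM fy fz /= addr0.
exists (mk (0%R, (f g).1.2, 0%R)) (mk (0%R, 0%R, (f g).2)).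
- exact: (mkY mkK memY).
- exact: (mkN mkK memN).
apply: (can_inj fK); rewrite fM !mkK heis_mulE mulmx0 !(addr0, add0r) -u0.
by case: (f g) => [[]].
Qed.

End CoordinateProducts.

Theorem theorem1p8 (n : nat) (n_ge2 : (2 <= n)%N) :
  (exists (gT : finGroupType) (x y : 'I_n -> gT), G_presented x y) /\
  forall (gT : finGroupType) (x y : 'I_n -> gT), G_presented x y ->
  let X := <<[set x i | i : 'I_n]>>%G in
  let Y := <<[set y i | i : 'I_n]>>%G in
  let N := <<[set [~ x i, y j] | i : 'I_n, j : 'I_n]>>%G in
  let Gamma := C_graph X Y in
  let Sigma := Sigma_graph X Y in
  let N_Sigma := Sigma_perms X Y N in
  let L := induced_on_orbits_group N_Sigma (Sigma_perms X Y [set: gT]%G) in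
  [/\ 2.-group [set: gT],
      [/\ mixed_dihedral X Y n, [set: gT]^`(1) = N & N \isog C2_pow (n ^ 2)],
      [/\ simple_connected_graph Sigma,
          two_arc_transitive Sigma,
          normal_cover N_Sigma Sigma (@complete_bipartite (2 ^ n)),
          #|Sigma_vertex X Y| = (2 ^ (n ^ 2 + n + 1))%N
        & (forall h : gT, (h \in N) =
             [forall B : orbit_type N_Sigma,
                [set Sigma_mul A h | A in val B] == val B])
          /\ edge_affine n (quotient_graph N_Sigma Sigma) L]
    &
      [/\ simple_connected_graph Gamma,
          two_geodesic_transitive Gamma,
          normal_cayley (C_conn X Y),
          two_distance_transitive Gamma
        & ~ distance_transitive Gamma /\ ~ two_arc_transitive Gamma]].
Proof.
split; first by exists (heis n), (@heis_x n), (@heis_y n); exact: heis_presented.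
move=> gT x y pres X Y N Gamma Sigma N_Sigma L.
have [f [mk fK mkK] [fM fx fy]] := presented_coordinates pres.
have f_bij : bijective f by exists mk.
have memX g : (g \in X) = ((f g).1.2 == 0%R) && ((f g).2 == 0%R).
  exact: (mem_coord_x f_bij fM fx fy).
have memY g : (g \in Y) = ((f g).1.1 == 0%R) && ((f g).2 == 0%R).
  exact: (mem_coord_y f_bij fM fx fy).
have memN g : (g \in N) = ((f g).1.1 == 0%R) && ((f g).1.2 == 0%R).
  exact: (mem_coord_z f_bij fM fx fy).
(* From here on X, Y and N are any subgroups with these descriptions in coordinates. *)
move: X Y N memX memY memN @Gamma @Sigma @N_Sigma @L => X Y N memX memY memN.
move=> Gamma Sigma N_Sigma L; clear x y pres fx fy f_bij.
have cG := card_coord fK mkK.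
have cX : #|X| = (2 ^ n)%N := cardX_coord fK mkK memX.
have cY : #|Y| = (2 ^ n)%N := cardY_coord fK mkK memY.
have cN : #|N| = (2 ^ (n ^ 2))%N := cardN_coord fK mkK memN.
have TI := coord_TI fK fM memX memY.
have genXY := coord_gen fK mkK fM memX memY memN.
have derN := coord_der fK mkK fM memN.
have centN := coord_central fK fM memN.
have abel := coord_abelem fK fM memX memY memN.
have swapXY := coord_swap fK mkK fM memX memY.
have autXY := coord_aut_transitive fK mkK fM memX memY.
(* As n >= 2, A has at least four elements, so one is left after removing 1 and g. *)
have nontriv2 (A : {group gT}) g : #|A| = (2 ^ n)%N -> g \in A ->
    exists2 a, a \in A^# & a != g.
  move=> cA Ag; have : (0 < #|A :\: [set 1%g; g]|)%N.
    rewrite cardsD subn_gt0; apply: leq_ltn_trans (subset_leq_card (subsetIr _ _)) _.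
    rewrite cards2 cA; apply: (@leq_trans (2 ^ 2)); last by rewrite leq_exp2l.
    by case: (1%g != g).
  case/card_gt0P=> a; rewrite !inE negb_or => /andP[/andP[a1 ag] Aa].
  by exists a; rewrite // !inE a1.
have octXY : octagon_pair X Y.
  split; [exact: TI | | | | ].
  - by move=> a Xa; apply: (coord_sqr fK fM memX memY memN); left.
  - exact: (coord_octagon fK fM memX memY).
  - exact: (coord_octagons fK fM memY).
  by move=> b Yb; apply: nontriv2.
have octYX : octagon_pair Y X.
  split; [by rewrite setIC | | | | ].
  - by move=> b Yb; apply: (coord_sqr fK fM memX memY memN); right; left.
  - exact/octagon_rigidC/(coord_octagon fK fM memX memY).
  - exact: (coord_octagonsC fK fM memX).
  by move=> a Xa; apply: nontriv2.
have X_nontriv : exists a, a \in X^#.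
  by case: (nontriv2 X 1 cX (group1 X)) => a; exists a.
have no_sq := coord_no_square fK fM memX memY.
have gT_gt3 : (3 < #|{: gT}|)%N.
  rewrite -cardsT cG; apply: (@leq_trans (2 ^ 2)) => //.
  by rewrite leq_exp2l // (leq_trans n_ge2) // mul2n -addnn addnA leq_addl.
(* The invariant of an X-coset is its y-part and that of a Y-coset its x-part, hence the crossed
   components here and in [mkc]. *)
pose c (b : bool) (g : gT) := if b then (f g).1.2 else (f g).1.1.
pose mkc (u v : 'rV['F_2]_n) := mk (v, u, 0%R).
have cM b g h : c b (g * h) = (c b g + c b h)%R by rewrite /c fM; case: b.
have c_mkt u v : c true (mkc u v) = u by rewrite /c /mkc mkK.
have c_mkf u v : c false (mkc u v) = v by rewrite /c /mkc mkK.
have c0P b g : (c b g == 0%R) = (g \in (if b then X else Y) * N).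
  by rewrite /c; case: b; [apply: (coord_X_N fK fM memX memN mkK)
    | apply: (coord_Y_N fK fM memY memN mkK)].
have memNc g : (g \in N) = (c true g == 0%R) && (c false g == 0%R).
  by rewrite memN andbC.
have index_2n (A : {group gT}) : #|A| = (2 ^ n)%N ->
    #|[set: gT] : A| = (2 ^ (n ^ 2 + n))%N.
  move=> cA; rewrite -divgS ?subsetT // cG cA -expnB ?leq_addl //.
    by rewrite mul2n -addnn addnA addnK.
  by rewrite mul2n -addnn addnA leq_addl.
split.
- by rewrite /pgroup cG pnatX.
- split; [|exact: derN|].
    split; [| | exact: genXY |].
    + by apply: abelem_isog_C2_pow => //; apply: abel; left.
    + by apply: abelem_isog_C2_pow => //; apply: abel; right; left.
    have nN : [set: gT] \subset 'N([set: gT]^`(1)) by apply: der_norm.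
    apply: abelem_isog_C2_pow.
      apply/abelemP => //; split; first exact: der_abelian.
      move=> _ /morphimP[g Ng _ ->]; rewrite -morphX //; apply: coset_id.
      have : g ^+ 2 \in N by rewrite expg2; apply: (coord_sqr_N fM memN).
      by rewrite -derN.
    have cD : #|[set: gT]^`(1)| = (2 ^ (n ^ 2))%N by rewrite derN.
    rewrite card_quotient // -divgS ?der_sub //= cD cG.
    by rewrite -expnB ?leq_addr // addKn.
  by apply: abelem_isog_C2_pow => //; apply: abel; right; right.
- split.
  + exact: Sigma_simple_connected.
  + exact: Sigma_two_arc_transitive.
  + exact: (Sigma_normal_cover TI X_nontriv centN derN swapXY cM c_mkt c_mkf c0P memNc).
  + rewrite card_Sigma_vertex // !index_2n //.
    by rewrite addnn -mul2n -expnS addn1.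
  split=> [h|].
    exact: (orbit_kernel TI X_nontriv centN cM c_mkt c_mkf c0P memNc).
  exact: (induced_edge_affine TI X_nontriv centN cM c_mkt c_mkf c0P memNc).
split.
- exact: C_simple_connected.
- exact: C_two_geodesic_transitive.
- exact: C_normal_cayley.
- exact: C_two_distance_transitive.
split; last exact: C_not_two_arc_transitive.
exact: C_not_distance_transitive.
Qed.
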